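(* For every positive equivalence relation $\eta$, there is an $\eta$-family which is behaviourally correctly learnable but not explanatorily learnable.
   Context: A positive equivalence relation is an equivalence relation $\eta$ on $\mathbb{N}$ that is recursively enumerable (as a set of pairs) and has infinitely many equivalence classes. A set is $\eta$-closed if it is a union of $\eta$-equivalence classes. An $\eta$-family is an infinite family of $\eta$-closed sets possessing a uniformly r.e. one-one numbering $B_0,B_1,\dots$ (i.e. $\{\langle k,x\rangle:x\in B_k\}$ is r.e. and $B_i\neq B_j$ for $i\ne j$). $W_0,W_1,\dots$ is a fixed acceptable numbering of the r.e. sets. A text for $L$ is a total $T:\mathbb N\to\mathbb N\cup\{\#\}$ whose range minus $\{\#\}$ is $L$; $T[n]$ is its initial segment of length $n$. A learner is a recursive function $M$ from finite sequences over $\mathbb N\cup\{\#\}$ to $\mathbb N\cup\{?\}$; an output $e$ is interpreted as the hypothesis ''the $\eta$-closure of $W_e$''. A family $\mathcal C$ is explanatorily learnable if some $M$, on every text $T$ for every $L\in\mathcal C$, outputs from some point on a single index whose hypothesis equals $L$; behaviourally correctly learnable if some $M$, on every such text, outputs for almost all $n$ an index $M(T[n])$ whose hypothesis equals $L$. *)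

(* Defs.v *)
(* Sets of naturals are Stdlib [Ensemble]s, compared with [=]
   (i.e. up to functional and propositional extensionality). *)
From Stdlib Require Import Arith List RelationClasses Cantor.
From Stdlib Require Import Ensembles Finite_sets Image.
Set Implicit Arguments.
Import ListNotations.

Notation "⟨ x , y ⟩" := (Cantor.to_nat (x, y)) (at level 0, x at level 99, y at level 99).

(* Programs for the unary partial recursive functions.  Several arguments are
   passed through the Cantor pairing bijection, whose inverse is given by the
   initial functions [Left] and [Right]. *)
Inductive code : Type :=
| Zero
| Succ
| Left
| Right
| Pair (f g : code)
| Comp (f g : code)
| Prec (f g : code)
| Mu (f : code).

(* [eval c n y]: the program [c] halts on input [n] with output [y].
   - [Prec f g] is the function h with h⟨a,0⟩ = f a and
     h⟨a,k+1⟩ = g ⟨a,⟨k,h⟨a,k⟩⟩⟩;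
   - [Mu f] sends n to the least y with f⟨n,y⟩ = 0, provided that f⟨n,m⟩ is
     defined for every m < y. *)
Fixpoint eval (c : code) (n y : nat) {struct c} : Prop :=
  match c with
  | Zero => y = 0
  | Succ => y = S n
  | Left => y = fst (Cantor.of_nat n)
  | Right => y = snd (Cantor.of_nat n)
  | Pair f g => exists u v, eval f n u /\ eval g n v /\ y = ⟨u, v⟩
  | Comp f g => exists z, eval g n z /\ eval f z y
  | Prec f g =>
      let (a, k) := Cantor.of_nat n in
      nat_rect (fun _ => nat -> Prop)
        (eval f a)
        (fun j h w => exists z, h z /\ eval g ⟨a, ⟨j, z⟩⟩ w)
        k y
  | Mu f =>
      eval f ⟨n, y⟩ 0 /\ forall m, m < y -> exists k, eval f ⟨n, m⟩ (S k)
  end.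

Definition recursive (f : nat -> nat) : Prop :=
  exists c, forall n, eval c n (f n).

Definition re (A : Ensemble nat) : Prop :=
  exists c, forall n, In _ A n <-> exists y, eval c n y.

Definition uniformly_re (B : nat -> Ensemble nat) : Prop :=
  re (fun p => let (k, x) := Cantor.of_nat p in In _ (B k) x).

(* A numbering of r.e. sets is acceptable (a Gödel numbering) when it is
   uniformly r.e. and every uniformly r.e. numbering is effectively
   translatable into it; in particular every r.e. set is some [W e]. *)
Definition acceptable (W : nat -> Ensemble nat) : Prop :=
  uniformly_re W /\
  forall V : nat -> Ensemble nat, uniformly_re V ->
    exists f, recursive f /\ forall i, V i = W (f i).

Definition eq_class (eta : nat -> nat -> Prop) (x : nat) : Ensemble nat :=
  fun y => eta x y.

Definition positive_equivalence (eta : nat -> nat -> Prop) : Prop :=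
  RelationClasses.Equivalence eta /\
  re (fun p => let (x, y) := Cantor.of_nat p in eta x y) /\
  ~ Finite _ (Im _ _ (Full_set nat) (eq_class eta)).

Definition closure (eta : nat -> nat -> Prop) (A : Ensemble nat) : Ensemble nat :=
  fun y => exists x, In _ A x /\ In _ (eq_class eta x) y.

(* [closure eta D] is the union of the classes of the elements of [D]. *)
Definition eta_closed (eta : nat -> nat -> Prop) (A : Ensemble nat) : Prop :=
  exists D : Ensemble nat, A = closure eta D.

Definition eta_family (eta : nat -> nat -> Prop) (C : Ensemble (Ensemble nat)) : Prop :=
  ~ Finite _ C /\
  (forall L, In _ C L -> eta_closed eta L) /\
  exists B : nat -> Ensemble nat,
    uniformly_re B /\ injective _ _ B /\ C = Im _ _ (Full_set nat) B.

(* In input sequences and texts [None] is the pause symbol #; in learner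
   outputs it is the symbol ?. *)
Definition encode_option (o : option nat) : nat :=
  match o with None => 0 | Some x => S x end.

Fixpoint encode_seq (s : list (option nat)) : nat :=
  match s with
  | [] => 0
  | o :: s' => S ⟨encode_option o, encode_seq s'⟩
  end.

Definition recursive_learner (M : list (option nat) -> option nat) : Prop :=
  exists c, forall s, eval c (encode_seq s) (encode_option (M s)).

Definition text_for (T : nat -> option nat) (L : Ensemble nat) : Prop :=
  forall x, In _ L x <-> exists n, T n = Some x.

Definition prefix (T : nat -> option nat) (n : nat) : list (option nat) :=
  map T (seq 0 n).

Definition explanatorily_learnable (W : nat -> Ensemble nat)
    (eta : nat -> nat -> Prop) (C : Ensemble (Ensemble nat)) : Prop :=
  exists M, recursive_learner M /\
    forall L, In _ C L -> forall T, text_for T L ->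
      exists e, closure eta (W e) = L /\
        exists N, forall n, N <= n -> M (prefix T n) = Some e.

Definition behaviourally_correctly_learnable (W : nat -> Ensemble nat)
    (eta : nat -> nat -> Prop) (C : Ensemble (Ensemble nat)) : Prop :=
  exists M, recursive_learner M /\
    forall L, In _ C L -> forall T, text_for T L ->
      exists N, forall n, N <= n ->
        exists e, M (prefix T n) = Some e /\ closure eta (W e) = L.

(* Main.v *)
(* If A is an r.e. union of classes that is not recursive, then the sets A ∪ D with
   D a finite union of classes would do, but such an A need not exist. Instead:

   A family of finite unions of classes is behaviourally correctly learnable by
   conjecturing the closure of the data. If the sets [u] ∪ [v] with u, v not
   equivalent to 0 do not form an explanatorily learnable family, we are done.
   Otherwise, a locking sequence of the learner for [u] yields an enumeration of
   the complement of [u], so that an index of this complement is found from u in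
   the limit. Fix a class [b] other than [0]. For the least elements x > b of
   classes, consider L_x = N \ ([b] ∪ [x]), and diagonalize against the learner
   whose number e is computed from the rank of x among the least elements: if this
   learner has a locking sequence for L_x, add F_x = L_x \ [z] for some z that does
   not meet the sequence. No explanatory learner survives. From the data, x is found
   in the limit, and the behaviourally correct learner conjectures the data
   together with the part of L_x that lies in all sets L_x, F_x whose current
   witnesses are never refuted; this is an r.e. condition.

   In both cases the sets are indexed by co-r.e. sets of witnesses. The numbering
   is made one-one and uniformly r.e. by turning every refuted index into an
   initial union J_k of the classes, with k used only once; that is a finite union,
   contains 0 and b, and is hence harmless to the learners. *)

From Stdlib Require Import Arith List Lia Classical ClassicalEpsilon.
From Stdlib Require FinFun.
From Stdlib Require Import FunctionalExtensionality PropExtensionality.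
From Stdlib Require Import Finite_sets Image RelationClasses Cantor.
Require Import Defs.
From Stdlib Require Import Ensembles.
Set Implicit Arguments.
Unset Strict Implicit.
Import ListNotations.

(** * Recursive functions *)

Definition pi1 (n : nat) : nat := fst (Cantor.of_nat n).
Definition pi2 (n : nat) : nat := snd (Cantor.of_nat n).

Lemma pi1_pair (x y : nat) : pi1 ⟨x, y⟩ = x.
Proof. unfold pi1; rewrite cancel_of_to; reflexivity. Qed.

Lemma pi2_pair (x y : nat) : pi2 ⟨x, y⟩ = y.
Proof. unfold pi2; rewrite cancel_of_to; reflexivity. Qed.

Lemma pair_pi (n : nat) : ⟨pi1 n, pi2 n⟩ = n.
Proof.
  unfold pi1, pi2; rewrite <- surjective_pairing; apply cancel_to_of.
Qed.

Lemma of_nat_pi (n : nat) : Cantor.of_nat n = (pi1 n, pi2 n).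
Proof. apply surjective_pairing. Qed.

Lemma pair_ge_l (x y : nat) : x <= ⟨x, y⟩.
Proof. pose proof (to_nat_non_decreasing x y); lia. Qed.

Lemma pair_ge_r (x y : nat) : y <= ⟨x, y⟩.
Proof. pose proof (to_nat_non_decreasing x y); lia. Qed.

Lemma pi2_le (n : nat) : pi2 n <= n.
Proof. rewrite <- (pair_pi n) at 2; apply pair_ge_r. Qed.

Lemma pair_inj (x y x' y' : nat) : ⟨x, y⟩ = ⟨x', y'⟩ -> x = x' /\ y = y'.
Proof.
  intro H; split; [rewrite <- (pi1_pair x y) | rewrite <- (pi2_pair x y)];
    rewrite H; [apply pi1_pair | apply pi2_pair].
Qed.

Global Opaque Cantor.to_nat Cantor.of_nat pi1 pi2.

Lemma rec_ext (f g : nat -> nat) :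
  recursive f -> (forall n, f n = g n) -> recursive g.
Proof. intros [c H] E; exists c; intro n; rewrite <- E; apply H. Qed.

Lemma rec_comp (h f : nat -> nat) :
  recursive h -> recursive f -> recursive (fun n => h (f n)).
Proof.
  intros [c H] [d K]; exists (Comp c d); intro n; exists (f n); auto.
Qed.

Lemma rec_pair (f g : nat -> nat) :
  recursive f -> recursive g -> recursive (fun n => ⟨f n, g n⟩).
Proof.
  intros [c H] [d K]; exists (Pair c d); intro n; exists (f n), (g n); auto.
Qed.

Lemma rec_S (f : nat -> nat) : recursive f -> recursive (fun n => S (f n)).
Proof. apply rec_comp; exists Succ; reflexivity. Qed.

Lemma rec_pi1 (f : nat -> nat) : recursive f -> recursive (fun n => pi1 (f n)).
Proof. apply rec_comp; exists Left; reflexivity. Qed.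

Lemma rec_pi2 (f : nat -> nat) : recursive f -> recursive (fun n => pi2 (f n)).
Proof. apply rec_comp; exists Right; reflexivity. Qed.

Lemma rec_id : recursive (fun n => n).
Proof.
  apply rec_ext with (fun n => ⟨pi1 n, pi2 n⟩); [|exact pair_pi].
  apply rec_pair; [exists Left | exists Right]; reflexivity.
Qed.

Lemma rec_const (c : nat) : recursive (fun _ => c).
Proof.
  induction c; [exists Zero; reflexivity | now apply rec_S].
Qed.

(** [Prec] receives parameter and counter as one pair, so the step function reads its arguments from
    [⟨n, ⟨j, z⟩⟩]. *)
Lemma rec_nat_rect (base : nat -> nat) (step : nat -> nat -> nat -> nat)
    (k : nat -> nat) :
  recursive base ->
  recursive (fun q => step (pi1 q) (pi1 (pi2 q)) (pi2 (pi2 q))) ->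
  recursive k ->
  recursive (fun n => nat_rect (fun _ => nat) (base n) (step n) (k n)).
Proof.
  intros [b Hb] [c Hc] [d Hd].
  destruct rec_id as [i Hi].
  exists (Comp (Prec b c) (Pair i d)); intro n.
  exists ⟨n, k n⟩; split; [exists n, (k n); auto|].
  cbn [eval]; rewrite cancel_of_to.
  induction (k n) as [|j IH]; simpl; [apply Hb|].
  eexists; split; [exact IH|].
  pose proof (Hc ⟨n, ⟨j, nat_rect (fun _ => nat) (base n) (step n) j⟩⟩) as H.
  now rewrite !pi1_pair, !pi2_pair, pi1_pair in H.
Qed.

Lemma rec_comp2 (h : nat -> nat -> nat) (f g : nat -> nat) :
  recursive (fun q => h (pi1 q) (pi2 q)) -> recursive f -> recursive g ->
  recursive (fun n => h (f n) (g n)).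
Proof.
  intros Hh Hf Hg.
  apply rec_ext with (fun n => (fun q => h (pi1 q) (pi2 q)) ⟨f n, g n⟩).
  - exact (rec_comp Hh (rec_pair Hf Hg)).
  - intro n; now rewrite pi1_pair, pi2_pair.
Qed.

Lemma rec_pred (f : nat -> nat) :
  recursive f -> recursive (fun n => Nat.pred (f n)).
Proof.
  intro Hf.
  apply rec_ext with (fun n => nat_rect (fun _ => nat) 0 (fun j _ => j) (f n)).
  - apply (@rec_nat_rect (fun _ => 0) (fun _ j _ => j)); auto using rec_const.
    apply rec_pi1, rec_pi2, rec_id.
  - intro n; destruct (f n); reflexivity.
Qed.

Lemma rec_plus (f g : nat -> nat) :
  recursive f -> recursive g -> recursive (fun n => f n + g n).
Proof.
  intros Hf Hg.
  apply rec_ext with (fun n => nat_rect (fun _ => nat) (f n) (fun _ z => S z) (g n)).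
  - apply (@rec_nat_rect f (fun _ _ z => S z)); auto.
    apply rec_S, rec_pi2, rec_pi2, rec_id.
  - intro n; induction (g n) as [|k IH]; simpl; lia.
Qed.

Lemma rec_minus (f g : nat -> nat) :
  recursive f -> recursive g -> recursive (fun n => f n - g n).
Proof.
  intros Hf Hg.
  apply rec_ext
    with (fun n => nat_rect (fun _ => nat) (f n) (fun _ z => Nat.pred z) (g n)).
  - apply (@rec_nat_rect f (fun _ _ z => Nat.pred z)); auto.
    apply rec_pred, rec_pi2, rec_pi2, rec_id.
  - intro n; induction (g n) as [|k IH]; simpl; lia.
Qed.

Lemma rec_mult (f g : nat -> nat) :
  recursive f -> recursive g -> recursive (fun n => f n * g n).
Proof.
  intros Hf Hg.
  apply rec_ext
    with (fun n => nat_rect (fun _ => nat) 0 (fun _ z => z + f n) (g n)).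
  - apply (@rec_nat_rect (fun _ => 0) (fun n _ z => z + f n));
      auto using rec_const.
    apply rec_plus; [apply rec_pi2, rec_pi2, rec_id|].
    apply (rec_comp Hf), rec_pi1, rec_id.
  - intro n; induction (g n) as [|k IH]; simpl; lia.
Qed.

Definition sum_below (h : nat -> nat) (k : nat) : nat :=
  nat_rect (fun _ => nat) 0 (fun j z => z + h j) k.

Lemma rec_sum (h : nat -> nat -> nat) (k : nat -> nat) :
  recursive (fun q => h (pi1 q) (pi2 q)) -> recursive k ->
  recursive (fun n => sum_below (h n) (k n)).
Proof.
  intros Hh Hk.
  apply (@rec_nat_rect (fun _ => 0) (fun n j z => z + h n j));
    auto using rec_const.
  apply rec_plus; [apply rec_pi2, rec_pi2, rec_id|].
  apply (rec_comp2 Hh); [|apply rec_pi1, rec_pi2]; auto using rec_id, rec_pi1.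
Qed.

Lemma sum_below_S (h : nat -> nat) (k : nat) :
  sum_below h (S k) = sum_below h k + h k.
Proof. reflexivity. Qed.

Lemma sum_below_0 (h : nat -> nat) (k : nat) :
  sum_below h k = 0 <-> forall j, j < k -> h j = 0.
Proof.
  induction k as [|k IH]; [|rewrite sum_below_S]; split; intro H.
  - intros; lia.
  - reflexivity.
  - intros j Hj; destruct (Nat.eq_dec j k); [subst; lia|].
    apply IH; lia.
  - rewrite (H k) by lia; rewrite (proj2 IH); [lia|].
    intros j Hj; apply H; lia.
Qed.

(** * Decidable and recursively enumerable predicates *)

(** The value 0 stands for truth, so conjunction becomes a sum, disjunction a product, and a bounded
    universal quantifier the sum [sum_below]. *)
Definition dec (P : nat -> Prop) : Prop :=
  exists f, recursive f /\ forall n, P n <-> f n = 0.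

Definition dec2 (R : nat -> nat -> Prop) : Prop :=
  dec (fun q => R (pi1 q) (pi2 q)).

Lemma dec_ext (P Q : nat -> Prop) :
  dec P -> (forall n, P n <-> Q n) -> dec Q.
Proof.
  intros [f [Hf H]] E; exists f; split; [exact Hf|].
  intro n; rewrite <- E; apply H.
Qed.

Lemma dec_comp (P : nat -> Prop) (f : nat -> nat) :
  dec P -> recursive f -> dec (fun n => P (f n)).
Proof.
  intros [g [Hg H]] Hf; exists (fun n => g (f n)); split.
  - now apply rec_comp.
  - intro n; apply H.
Qed.

Lemma dec2_comp (R : nat -> nat -> Prop) (f g : nat -> nat) :
  dec2 R -> recursive f -> recursive g -> dec (fun n => R (f n) (g n)).
Proof.
  intros HR Hf Hg.
  apply (dec_ext (dec_comp HR (rec_pair Hf Hg))).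
  intro n; now rewrite pi1_pair, pi2_pair.
Qed.

Lemma dec_le (f g : nat -> nat) :
  recursive f -> recursive g -> dec (fun n => f n <= g n).
Proof.
  intros Hf Hg; exists (fun n => f n - g n); split.
  - now apply rec_minus.
  - intro n; lia.
Qed.

Lemma dec_lt (f g : nat -> nat) :
  recursive f -> recursive g -> dec (fun n => f n < g n).
Proof. intros Hf Hg; apply (dec_le (rec_S Hf) Hg). Qed.

Lemma dec_and (P Q : nat -> Prop) :
  dec P -> dec Q -> dec (fun n => P n /\ Q n).
Proof.
  intros [f [Hf HP]] [g [Hg HQ]]; exists (fun n => f n + g n); split.
  - now apply rec_plus.
  - intro n; rewrite HP, HQ; lia.
Qed.

Lemma dec_or (P Q : nat -> Prop) :
  dec P -> dec Q -> dec (fun n => P n \/ Q n).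
Proof.
  intros [f [Hf HP]] [g [Hg HQ]]; exists (fun n => f n * g n); split.
  - now apply rec_mult.
  - intro n; rewrite HP, HQ; nia.
Qed.

Lemma dec_not (P : nat -> Prop) : dec P -> dec (fun n => ~ P n).
Proof.
  intros [f [Hf HP]]; exists (fun n => 1 - f n); split.
  - apply rec_minus; auto using rec_const.
  - intro n; rewrite HP; lia.
Qed.

Lemma dec_eq (f g : nat -> nat) :
  recursive f -> recursive g -> dec (fun n => f n = g n).
Proof.
  intros Hf Hg; apply dec_ext with (fun n => f n <= g n /\ g n <= f n).
  - apply dec_and; now apply dec_le.
  - intro n; lia.
Qed.

Lemma dec_forall (R : nat -> nat -> Prop) (k : nat -> nat) :
  dec2 R -> recursive k -> dec (fun n => forall m, m < k n -> R n m).
Proof.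
  intros [f [Hf HR]] Hk.
  exists (fun n => sum_below (fun m => f ⟨n, m⟩) (k n)); split.
  - apply (@rec_sum (fun n m => f ⟨n, m⟩)); [|exact Hk].
    apply (rec_comp Hf), rec_pair; [apply rec_pi1 | apply rec_pi2]; apply rec_id.
  - intro n; rewrite sum_below_0.
    split; intros H m Hm; specialize (H m Hm);
      specialize (HR ⟨n, m⟩); rewrite pi1_pair, pi2_pair in HR; tauto.
Qed.

Lemma dec_exists (R : nat -> nat -> Prop) (k : nat -> nat) :
  dec2 R -> recursive k -> dec (fun n => exists m, m < k n /\ R n m).
Proof.
  intros HR Hk.
  apply dec_ext with (fun n => ~ forall m, m < k n -> ~ R n m).
  - apply dec_not, dec_forall; [now apply dec_not | exact Hk].
  - intro n; split.
    + intro H; apply NNPP; intro K; apply H; intros m Hm HRm; eauto.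
    + intros [m [Hm HRm]] H; exact (H m Hm HRm).
Qed.

(** Projections of decidable relations have convenient closure properties; [re_sig] identifies them
    with the r.e. sets. *)
Definition sig (P : nat -> Prop) : Prop :=
  exists D, dec2 D /\ forall n, P n <-> exists s, D n s.

Definition sig2 (R : nat -> nat -> Prop) : Prop :=
  sig (fun q => R (pi1 q) (pi2 q)).

Definition sig3 (R : nat -> nat -> nat -> Prop) : Prop :=
  sig (fun q => R (pi1 q) (pi1 (pi2 q)) (pi2 (pi2 q))).

Lemma sig_ext (P Q : nat -> Prop) :
  sig P -> (forall n, P n <-> Q n) -> sig Q.
Proof.
  intros [D [HD H]] E; exists D; split; [exact HD|].
  intro n; rewrite <- E; apply H.
Qed.

Lemma sig_dec (P : nat -> Prop) : dec P -> sig P.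
Proof.
  intro H; exists (fun n _ => P n); split.
  - apply (dec_comp H), rec_pi1, rec_id.
  - intro n; split; [exists 0; auto | now intros [_ K]].
Qed.

(** Reading [s] as a bound on the search for a witness makes stages cumulative, so that finitely
    many confirmations share a stage. *)
Lemma sig_mono (P : nat -> Prop) :
  sig P -> exists D, dec2 D /\ (forall n s t, s <= t -> D n s -> D n t) /\
    forall n, P n <-> exists s, D n s.
Proof.
  intros [D [HD H]]; exists (fun n s => exists m, m < S s /\ D n m).
  split; [|split].
  - apply (@dec_exists (fun q m => D (pi1 q) m)).
    + apply (dec2_comp HD); auto using rec_pi1, rec_pi2, rec_id.
    + apply rec_S, rec_pi2, rec_id.
  - intros n s t Hst [m [Hm K]]; exists m; split; [lia | exact K].
  - intro n; rewrite H; split.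
    + intros [s K]; exists s, s; split; [lia | exact K].
    + intros [s [m [_ K]]]; eauto.
Qed.

Lemma sig_comp (P : nat -> Prop) (f : nat -> nat) :
  sig P -> recursive f -> sig (fun n => P (f n)).
Proof.
  intros [D [HD H]] Hf; exists (fun n s => D (f n) s); split.
  - apply (dec2_comp HD); [apply (rec_comp Hf), rec_pi1 | apply rec_pi2];
      apply rec_id.
  - intro n; apply H.
Qed.

Lemma sig2_comp (R : nat -> nat -> Prop) (f g : nat -> nat) :
  sig2 R -> recursive f -> recursive g -> sig (fun n => R (f n) (g n)).
Proof.
  intros HR Hf Hg.
  apply (sig_ext (sig_comp HR (rec_pair Hf Hg))).
  intro n; now rewrite pi1_pair, pi2_pair.
Qed.

Lemma sig3_comp (R : nat -> nat -> nat -> Prop) (f g h : nat -> nat) :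
  sig3 R -> recursive f -> recursive g -> recursive h ->
  sig (fun n => R (f n) (g n) (h n)).
Proof.
  intros HR Hf Hg Hh.
  apply (sig_ext (sig_comp HR (rec_pair Hf (rec_pair Hg Hh)))).
  intro n; now rewrite !pi2_pair, !pi1_pair.
Qed.

Lemma sig_and (P Q : nat -> Prop) :
  sig P -> sig Q -> sig (fun n => P n /\ Q n).
Proof.
  intros [D [HD HP]] [E [HE HQ]].
  exists (fun n s => D n (pi1 s) /\ E n (pi2 s)); split.
  - apply dec_and; [apply (dec2_comp HD) | apply (dec2_comp HE)];
      auto using rec_pi1, rec_pi2, rec_id.
  - intro n; rewrite HP, HQ; split.
    + intros [[s Hs] [t Ht]]; exists ⟨s, t⟩; now rewrite pi1_pair, pi2_pair.
    + intros [s [H K]]; eauto.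
Qed.

Lemma sig_or (P Q : nat -> Prop) :
  sig P -> sig Q -> sig (fun n => P n \/ Q n).
Proof.
  intros [D [HD HP]] [E [HE HQ]].
  exists (fun n s => D n s \/ E n s); split.
  - now apply dec_or.
  - intro n; rewrite HP, HQ; split.
    + intros [[s Hs] | [s Hs]]; eauto.
    + intros [s [H | H]]; eauto.
Qed.

Lemma sig_exists (R : nat -> nat -> Prop) :
  sig2 R -> sig (fun n => exists m, R n m).
Proof.
  intros [D [HD H]]; exists (fun n s => D ⟨n, pi1 s⟩ (pi2 s)); split.
  - apply (dec2_comp HD).
    + apply rec_pair; [|apply rec_pi1]; auto using rec_pi1, rec_pi2, rec_id.
    + apply rec_pi2, rec_pi2, rec_id.
  - intro n; split.
    + intros [m Hm]; destruct (proj1 (H ⟨n, m⟩)) as [s Hs].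
      * now rewrite pi1_pair, pi2_pair.
      * exists ⟨m, s⟩; now rewrite pi1_pair, pi2_pair.
    + intros [s Hs]; exists (pi1 s).
      pose proof (proj2 (H ⟨n, pi1 s⟩) (ex_intro _ _ Hs)) as K.
      now rewrite pi1_pair, pi2_pair in K.
Qed.

Lemma sig_forall (R : nat -> nat -> Prop) (k : nat -> nat) :
  sig2 R -> recursive k -> sig (fun n => forall m, m < k n -> R n m).
Proof.
  intros HR Hk; destruct (sig_mono HR) as [D [HD [HM H]]].
  exists (fun n s => forall m, m < k n -> D ⟨n, m⟩ s); split.
  - apply (@dec_forall (fun q m => D ⟨pi1 q, m⟩ (pi2 q))).
    + apply (dec2_comp HD); [apply rec_pair|];
        auto using rec_pi1, rec_pi2, rec_id.
    + apply (rec_comp Hk), rec_pi1, rec_id.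
  - intro n.
    assert (E : forall m, R n m <-> exists s, D ⟨n, m⟩ s).
    { intro m; rewrite <- H, pi1_pair, pi2_pair; tauto. }
    induction (k n) as [|j IH]; split.
    + intros _; exists 0; intros; lia.
    + intros; lia.
    + intro A; destruct (proj1 IH) as [s Hs]; [intros; apply A; lia|].
      destruct (proj1 (E j) (A j (le_n _))) as [t Ht].
      exists (s + t); intros m Hm.
      destruct (Nat.eq_dec m j) as [->|N].
      * apply HM with t; [lia | exact Ht].
      * apply HM with s; [lia | apply Hs; lia].
    + intros [s Hs] m Hm; apply E; eauto.
Qed.

(** * Automation for recursive functions, decidable and r.e. predicates *)

Ltac solve_rec :=
  cbv beta; lazymatch goal with
  | |- recursive (fun n => n) => apply rec_id
  | |- recursive (fun _ => ?c) => apply rec_const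
  | |- recursive S => apply (rec_S rec_id)
  | |- recursive pi1 => apply (rec_pi1 rec_id)
  | |- recursive pi2 => apply (rec_pi2 rec_id)
  | |- recursive (fun n => S (@?f n)) => apply (@rec_S f); solve_rec
  | |- recursive (fun n => pi1 (@?f n)) => apply (@rec_pi1 f); solve_rec
  | |- recursive (fun n => pi2 (@?f n)) => apply (@rec_pi2 f); solve_rec
  | |- recursive (fun n => Nat.pred (@?f n)) => apply (@rec_pred f); solve_rec
  | |- recursive (fun n => Cantor.to_nat (@?f n, @?g n)) =>
      apply (@rec_pair f g); solve_rec
  | |- recursive (fun n => @?f n + @?g n) => apply (@rec_plus f g); solve_rec
  | |- recursive (fun n => @?f n - @?g n) => apply (@rec_minus f g); solve_rec
  | H : recursive ?h |- recursive (fun n => ?h (@?f n)) =>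
      apply (@rec_comp h f H); solve_rec
  | _ => auto with recdb
  end.

Ltac solve_dec :=
  cbv beta; lazymatch goal with
  | |- dec2 _ => unfold dec2; cbv beta; solve_dec
  | |- dec (fun n => ~ (@?P n)) => apply (@dec_not P); solve_dec
  | |- dec (fun n => @?P n /\ @?Q n) => apply (@dec_and P Q); solve_dec
  | |- dec (fun n => @?P n \/ @?Q n) => apply (@dec_or P Q); solve_dec
  | |- dec (fun n => @?f n = @?g n) => apply (@dec_eq f g); solve_rec
  | |- dec (fun n => @?f n <= @?g n) => apply (@dec_le f g); solve_rec
  | |- dec (fun n => @?f n < @?g n) => apply (@dec_lt f g); solve_rec
  | |- dec (fun n => forall m, m < @?k n -> @?R n m) =>
      apply (@dec_forall R k); [solve_dec | solve_rec]
  | |- dec (fun n => exists m, m < @?k n /\ @?R n m) =>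
      apply (@dec_exists R k); [solve_dec | solve_rec]
  | H : dec2 ?R |- dec (fun n => ?R (@?f n) (@?g n)) =>
      apply (@dec2_comp R f g H); solve_rec
  | _ => auto with recdb
  end.

Ltac solve_sig :=
  cbv beta; lazymatch goal with
  | |- sig2 _ => unfold sig2; cbv beta; solve_sig
  | |- sig3 _ => unfold sig3; cbv beta; solve_sig
  | |- sig (fun n => exists m, @?R n m) => apply (@sig_exists R); solve_sig
  | |- sig (fun n => forall m, m < @?k n -> @?R n m) =>
      apply (@sig_forall R k); [solve_sig | solve_rec]
  | |- sig (fun n => @?P n /\ @?Q n) => apply (@sig_and P Q); solve_sig
  | |- sig (fun n => @?P n \/ @?Q n) => apply (@sig_or P Q); solve_sig
  | H : sig ?R |- sig (fun n => ?R (@?f n)) =>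
      apply (@sig_comp R f H); solve_rec
  | H : sig2 ?R |- sig (fun n => ?R (@?f n) (@?g n)) =>
      apply (@sig2_comp R f g H); solve_rec
  | H : sig3 ?R |- sig (fun n => ?R (@?f n) (@?g n) (@?h n)) =>
      apply (@sig3_comp R f g h H); solve_rec
  | _ => first [solve [auto with recdb] | apply sig_dec; solve_dec]
  end.

Create HintDb recdb.

(** * Codes of finite sequences *)

(** Each step removes the first entry; the code 0 of the empty sequence is a fixed point because
    [pi2 0 = 0]. *)
Definition seq_tail (k r : nat) : nat :=
  nat_rect (fun _ => nat) r (fun _ z => pi2 (Nat.pred z)) k.

(* The code of the entry in position [k], hence [0], the code of a pause, from
   the end of the sequence on. *)
Definition entry (r k : nat) : nat := pi1 (Nat.pred (seq_tail k r)).

Lemma rec_seq_tail (f g : nat -> nat) :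
  recursive f -> recursive g -> recursive (fun n => seq_tail (f n) (g n)).
Proof.
  intros Hf Hg.
  apply (@rec_nat_rect g (fun _ _ z => pi2 (Nat.pred z))); [assumption| |assumption].
  solve_rec.
Qed.
#[global] Hint Extern 1 (recursive _) =>
  lazymatch goal with
  | |- recursive (fun n => seq_tail (@?f n) (@?g n)) =>
      apply (@rec_seq_tail f g); solve_rec
  end : recdb.

Lemma rec_entry (f g : nat -> nat) :
  recursive f -> recursive g -> recursive (fun n => entry (f n) (g n)).
Proof. intros; unfold entry; solve_rec. Qed.
#[global] Hint Extern 1 (recursive _) =>
  lazymatch goal with
  | |- recursive (fun n => entry (@?f n) (@?g n)) =>
      apply (@rec_entry f g); solve_rec
  end : recdb.

Lemma seq_tail_encode (s : list (option nat)) (k : nat) :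
  seq_tail k (encode_seq s) = encode_seq (skipn k s).
Proof.
  induction k as [|k IH]; [now rewrite skipn_O|].
  change (seq_tail (S k) (encode_seq s))
    with (pi2 (Nat.pred (seq_tail k (encode_seq s)))).
  rewrite IH; clear IH; revert s.
  assert (E0 : pi2 0 = 0) by (pose proof (pi2_le 0); lia).
  induction k as [|k IH]; intros [|o s]; try exact E0.
  - rewrite skipn_O; cbn [encode_seq skipn Nat.pred]; now rewrite pi2_pair.
  - exact (IH s).
Qed.

Lemma entry_encode (s : list (option nat)) (k : nat) :
  entry (encode_seq s) k = encode_option (nth k s None).
Proof.
  unfold entry; rewrite seq_tail_encode; revert s.
  assert (E0 : pi1 0 = 0).
  { pose proof (pair_ge_l (pi1 0) (pi2 0)) as H; rewrite pair_pi in H; lia. }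
  induction k as [|k IH]; intros [|o s]; try exact E0.
  - rewrite skipn_O; cbn [encode_seq Nat.pred nth]; apply pi1_pair.
  - exact (IH s).
Qed.

Lemma length_encode (s : list (option nat)) : length s <= encode_seq s.
Proof.
  induction s as [|o s IH]; simpl; [lia|].
  pose proof (pair_ge_r (encode_option o) (encode_seq s)); lia.
Qed.

Definition decode_option (k : nat) : option nat :=
  match k with 0 => None | S x => Some x end.

Lemma encode_decode_option (k : nat) : encode_option (decode_option k) = k.
Proof. destruct k; reflexivity. Qed.

Lemma encode_option_inj (o o' : option nat) :
  encode_option o = encode_option o' -> o = o'.
Proof. destruct o, o'; simpl; congruence. Qed.

Lemma encode_seq_inj (s s' : list (option nat)) :
  encode_seq s = encode_seq s' -> s = s'.
Proof.
  revert s'; induction s as [|o s IH]; intros [|o' s']; try discriminate; auto.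
  cbn [encode_seq]; intro H; injection H as H.
  apply pair_inj in H as [H1 H2]; f_equal; auto using encode_option_inj.
Qed.

Lemma encode_seq_surj (n : nat) : exists s, encode_seq s = n.
Proof.
  induction n as [n IH] using lt_wf_ind; destruct n as [|m]; [now exists []|].
  destruct (IH (pi2 m)) as [s Hs]; [pose proof (pi2_le m); lia|].
  exists (decode_option (pi1 m) :: s); cbn [encode_seq].
  rewrite encode_decode_option, Hs, pair_pi; reflexivity.
Qed.

(** Obtained by choice and used only in specifications; computations work on codes through [entry]
    and [append]. *)
Definition decode (n : nat) : list (option nat) :=
  proj1_sig (constructive_indefinite_description _ (encode_seq_surj n)).

Lemma encode_decode (n : nat) : encode_seq (decode n) = n.
Proof. exact (proj2_sig (constructive_indefinite_description _ (encode_seq_surj n))). Qed.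

Lemma decode_encode (s : list (option nat)) : decode (encode_seq s) = s.
Proof. apply encode_seq_inj, encode_decode. Qed.

Lemma entry_decode (r k : nat) :
  entry r k = encode_option (nth k (decode r) None).
Proof. rewrite <- (encode_decode r) at 1; apply entry_encode. Qed.

(** The code [r] bounds the length of its sequence, so the positions [r - 1] down to 0 are scanned.
    The factor [1 - seq_tail (r - S j) r] is 1 exactly when the position lies past the end; then [z]
    is kept, and otherwise the entry is put in front of it. *)
Definition append (r t : nat) : nat :=
  nat_rect (fun _ => nat) t
    (fun j z => (1 - seq_tail (r - S j) r) * z +
       (1 - (1 - seq_tail (r - S j) r)) * S ⟨entry r (r - S j), z⟩) r.

Lemma rec_append (f g : nat -> nat) :
  recursive f -> recursive g -> recursive (fun n => append (f n) (g n)).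
Proof.
  intros Hf Hg; unfold append.
  apply (@rec_nat_rect g (fun n j z => (1 - seq_tail (f n - S j) (f n)) * z +
    (1 - (1 - seq_tail (f n - S j) (f n))) * S ⟨entry (f n) (f n - S j), z⟩));
    [assumption| |assumption].
  apply rec_plus; apply rec_mult; solve_rec.
Qed.
#[global] Hint Extern 1 (recursive _) =>
  lazymatch goal with
  | |- recursive (fun n => append (@?f n) (@?g n)) =>
      apply (@rec_append f g); solve_rec
  end : recdb.

Lemma append_encode (s t : list (option nat)) :
  append (encode_seq s) (encode_seq t) = encode_seq (s ++ t).
Proof.
  unfold append; set (r := encode_seq s).
  assert (H : forall j, j <= r ->
    nat_rect (fun _ => nat) (encode_seq t)
      (fun j z => (1 - seq_tail (r - S j) r) * z +
        (1 - (1 - seq_tail (r - S j) r)) * S ⟨entry r (r - S j), z⟩) j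
    = encode_seq (skipn (r - j) s ++ t)).
  2: { rewrite (H r (le_n r)), Nat.sub_diag, skipn_O; reflexivity. }
  induction j as [|j IH]; intro Hj.
  - rewrite skipn_all2; [reflexivity|].
    pose proof (length_encode s) as L; fold r in L; lia.
  - cbn [nat_rect]; rewrite IH by lia; clear IH.
    replace (r - j) with (S (r - S j)) by lia.
    generalize (r - S j) as i; intro i; unfold r.
    rewrite seq_tail_encode, entry_encode; clear.
    revert i; induction s as [|o s IH]; intros [|i].
    + simpl; lia.
    + simpl; lia.
    + rewrite !skipn_O; cbn [encode_seq skipn nth app]; lia.
    + exact (IH i).
Qed.

Lemma append_decode (r t : nat) :
  append r t = encode_seq (decode r ++ decode t).
Proof. now rewrite <- append_encode, !encode_decode. Qed.

(** * The normal form theorem *)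

(** Only [Prec] needs an argument: its iteration has unbounded depth and is replaced by one coded
    sequence of intermediate values. *)
Lemma sig_eval (c : code) : sig2 (eval c).
Proof.
  induction c as [| | | |f Hf g Hg|f Hf g Hg|f Hf g Hg|f Hf]; cbn [eval].
  - solve_sig.
  - solve_sig.
  - change (sig2 (fun n y => y = pi1 n)); solve_sig.
  - change (sig2 (fun n y => y = pi2 n)); solve_sig.
  - solve_sig.
  - solve_sig.
  (* The entries 0 to [k] of [q] are the values of the recursion at 0 to [k]. *)
  - apply sig_ext with (fun p => exists q,
      eval f (pi1 (pi1 p)) (entry q 0) /\
      (forall j, j < pi2 (pi1 p) ->
        eval g ⟨pi1 (pi1 p), ⟨j, entry q j⟩⟩ (entry q (S j))) /\
      pi2 p = entry q (pi2 (pi1 p))); [solve_sig|].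
    intro p; rewrite of_nat_pi.
    generalize (pi1 (pi1 p)) as a, (pi2 (pi1 p)) as k, (pi2 p) as y; clear.
    intros a k y; split.
    + intros [q [H0 [HS ->]]].
      induction k as [|k IH]; simpl; [exact H0|].
      exists (entry q k); split; [apply IH; intros; apply HS; lia|].
      apply HS; lia.
    + intro H.
      assert (V : exists v, eval f a (v 0) /\
        (forall j, j < k -> eval g ⟨a, ⟨j, v j⟩⟩ (v (S j))) /\ y = v k).
      { revert y H; induction k as [|k IH]; simpl; intros y H.
        - exists (fun _ => y); repeat split; [exact H | intros; lia].
        - destruct H as [z [Hz Hy]], (IH z Hz) as [v [V0 [VS ->]]].
          exists (fun j => if j <=? k then v j else y); repeat split.
          + exact V0.
          + intros j Hj.
            destruct (Nat.leb_spec j k), (Nat.leb_spec (S j) k); try lia.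
            * apply VS; lia.
            * replace j with k by lia; exact Hy.
          + now destruct (Nat.leb_spec (S k) k); [lia|]. }
      destruct V as [v [V0 [VS ->]]].
      set (s := map (fun j => decode_option (v j)) (seq 0 (S k))).
      assert (E : forall j, j <= k -> entry (encode_seq s) j = v j).
      { intros j Hj; rewrite entry_encode; unfold s.
        rewrite nth_indep with (d' := decode_option (v 0))
          by (rewrite length_map, length_seq; lia).
        rewrite (map_nth (fun j => decode_option (v j))), seq_nth by lia.
        apply encode_decode_option. }
      exists (encode_seq s); rewrite !E by lia.
      repeat split; [exact V0|].
      intros j Hj; rewrite !E by lia; auto.
  - solve_sig.
Qed.

(** Conversely to the normal form, [Mu] searches for the least zero of a decision function. *)
Lemma re_sig (A : Ensemble nat) : re A <-> sig A.
Proof.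
  split.
  - intros [c H]; pose proof (sig_eval c).
    apply sig_ext with (fun n => exists y, eval c n y); [solve_sig|].
    intro n; symmetry; apply H.
  - intros [D [[f [[c Hc] Hf]] H]]; exists (Mu c); intro n.
    unfold In; rewrite H.
    assert (E : forall s, D n s <-> f ⟨n, s⟩ = 0).
    { intro s; specialize (Hf ⟨n, s⟩); now rewrite pi1_pair, pi2_pair in Hf. }
    split.
    + intros [s Hs]; revert Hs; induction s as [s IH] using lt_wf_ind; intro Hs.
      destruct (classic (exists m, m < s /\ D n m)) as [[m [Hm Dm]]|N].
      * exact (IH m Hm Dm).
      * exists s; cbn [eval]; split.
        -- rewrite <- (proj1 (E s) Hs); apply Hc.
        -- intros m Hm; exists (Nat.pred (f ⟨n, m⟩)).
           replace (S (Nat.pred (f ⟨n, m⟩))) with (f ⟨n, m⟩); [apply Hc|].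
           assert (f ⟨n, m⟩ <> 0); [|lia].
           intro F; apply N; exists m; split; [exact Hm | now apply E].
    + intros [y [Hy _]]; exists y; apply E.
      (* Programs are deterministic, so the value 0 seen by [Mu] is the value of the decision
         function. *)
      assert (U : forall m x y, eval c m x -> eval c m y -> x = y).
      { clear; induction c as [| | | |f Hf g Hg|f Hf g Hg|f Hf g Hg|f Hf];
          cbn [eval]; intros m x y; try congruence.
        - intros (u & v & Hu & Hv & ->) (u' & v' & Hu' & Hv' & ->).
          f_equal; f_equal; eauto.
        - intros (z & Hz & Hx) (z' & Hz' & Hy).
          rewrite (Hg _ _ _ Hz Hz') in *; eauto.
        - rewrite of_nat_pi; generalize (pi1 m) as a, (pi2 m) as k.
          intros a k; revert x y; induction k as [|k IH]; simpl; [apply Hf|].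
          intros x y (z & Hz & Hx) (z' & Hz' & Hy).
          rewrite (IH _ _ Hz Hz') in *; eauto.
        - intros [Hx Lx] [Hy Ly].
          destruct (Nat.lt_total x y) as [L|[L|L]]; [|exact L|].
          + destruct (Ly x L) as [k Hk].
            discriminate (Hf _ _ _ Hx Hk).
          + destruct (Lx y L) as [k Hk].
            discriminate (Hf _ _ _ Hy Hk). }
      eapply U; [apply Hc | exact Hy].
Qed.

Lemma uniformly_re_sig (B : nat -> Ensemble nat) : uniformly_re B <-> sig2 B.
Proof.
  unfold uniformly_re; rewrite re_sig.
  split; intro H; apply (sig_ext H); intro p; rewrite of_nat_pi; reflexivity.
Qed.

(** * Classes of a positive equivalence relation *)

Lemma set_ext (A B : Ensemble nat) : (forall x, A x <-> B x) -> A = B.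
Proof.
  intro H; apply functional_extensionality; intro x.
  apply propositional_extensionality, H.
Qed.

Lemma finite_list (U : Type) (A : Ensemble U) :
  Finite U A -> exists l, forall x, In U A x -> List.In x l.
Proof.
  induction 1 as [|A HA [l Hl] x Hx].
  - exists []; intros x [].
  - exists (x :: l); intros y [z Hz|z Hz].
    + right; auto.
    + left; now destruct Hz.
Qed.

Lemma list_finite (U : Type) (l : list U) (A : Ensemble U) :
  (forall x, In U A x -> List.In x l) -> Finite U A.
Proof.
  revert A; induction l as [|a l IH]; intros A H.
  - replace A with (Empty_set U); [constructor|].
    apply Extensionality_Ensembles; split; intros x Hx; [destruct Hx|].
    destruct (H x Hx).
  - assert (F : Finite U (Subtract U A a)).
    { apply IH; intros x [Hx N]; destruct (H x Hx) as [->|K]; [|exact K].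
      now destruct N. }
    destruct (classic (In U A a)) as [Ha|Ha].
    + replace A with (Add U (Subtract U A a) a).
      * apply Union_is_finite; [exact F|]; intros [_ N]; apply N; constructor.
      * apply Extensionality_Ensembles; split; intros x Hx.
        -- destruct Hx as [x [Hx _]|x Hx]; [exact Hx | now destruct Hx].
        -- destruct (classic (a = x)) as [<-|N]; [right; constructor|].
           left; split; [exact Hx|]; intro K; now apply N, Singleton_inv.
    + replace A with (Subtract U A a); [exact F|].
      apply Extensionality_Ensembles; split; intros x Hx; [apply Hx|].
      split; [exact Hx|]; intro K; apply Singleton_inv in K; now subst.
Qed.

Lemma injective_Im_infinite (U : Type) (B : nat -> U) :
  injective nat U B -> ~ Finite U (Im nat U (Full_set nat) B).
Proof.
  intros HB F; destruct (finite_list F) as [l Hl].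
  assert (N : NoDup (map B (seq 0 (S (length l))))).
  { apply FinFun.Injective_map_NoDup; [exact HB | apply seq_NoDup]. }
  apply NoDup_incl_length with (l' := l) in N.
  - rewrite length_map, length_seq in N; lia.
  - intros x Hx; apply in_map_iff in Hx as [n [<- _]].
    apply Hl, Im_intro with n; [constructor | reflexivity].
Qed.

Section PositiveEquivalence.

Context (eta : nat -> nat -> Prop).
Context (eta_equiv : Equivalence eta) (eta_sig : sig2 eta).
Context (eta_infinite : ~ Finite _ (Im _ _ (Full_set nat) (eq_class eta))).

Definition saturated (A : nat -> Prop) : Prop :=
  forall x y, eta x y -> A x -> A y.

Lemma closure_saturated (A : Ensemble nat) : saturated A -> closure eta A = A.
Proof.
  intro H; apply set_ext; intro x; split.
  - intros [y [Hy E]]; exact (H y x E Hy).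
  - intro Hx; exists x; split; [exact Hx | unfold In, eq_class; reflexivity].
Qed.

(** * Least elements of classes and their ranks *)

Definition nonmin (y : nat) : Prop := exists z, z < y /\ eta z y.

Lemma sig_nonmin : sig nonmin.
Proof. unfold nonmin; solve_sig. Qed.

Lemma min_representative (x : nat) : exists y, y <= x /\ ~ nonmin y /\ eta y x.
Proof.
  induction x as [x IH] using lt_wf_ind.
  destruct (classic (nonmin x)) as [[z [Hz E]]|N].
  - destruct (IH z Hz) as [y [Hy [M E']]]; exists y.
    repeat split; [lia | exact M | now transitivity z].
  - exists x; repeat split; [lia | exact N | reflexivity].
Qed.

Lemma min_unique (x y : nat) : ~ nonmin x -> ~ nonmin y -> eta x y -> x = y.
Proof.
  intros Hx Hy E; destruct (Nat.lt_total x y) as [L|[L|L]]; [|exact L|].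
  - destruct Hy; now exists x.
  - destruct Hx; exists y; split; [exact L | now symmetry].
Qed.

(** If all least elements were below [m], the classes of the numbers below [m] would be all
    classes. *)
Lemma min_unbounded (m : nat) : exists y, m <= y /\ ~ nonmin y.
Proof.
  apply NNPP; intro N; apply eta_infinite.
  apply list_finite with (map (eq_class eta) (seq 0 m)).
  intros A [x _ B ->].
  destruct (min_representative x) as [y [Hy [M E]]].
  apply in_map_iff; exists y; split.
  - apply set_ext; intro z; unfold eq_class; split; intro K.
    + transitivity y; [now symmetry | exact K].
    + now transitivity x.
  - apply in_seq; destruct (le_lt_dec m y); [destruct N; eauto | lia].
Qed.

(** The number of least elements below the argument, defined classically since [nonmin] is merely
    r.e. *)
Definition rank : nat -> nat :=
  sum_below (fun y => if excluded_middle_informative (nonmin y) then 0 else 1).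

Lemma rank_S (x : nat) :
  rank (S x) =
    rank x + if excluded_middle_informative (nonmin x) then 0 else 1.
Proof. reflexivity. Qed.

Lemma rank_S_min (x : nat) : ~ nonmin x -> rank (S x) = S (rank x).
Proof.
  intro H; rewrite rank_S; destruct excluded_middle_informative; [easy | lia].
Qed.

Lemma rank_mono (x y : nat) : x <= y -> rank x <= rank y.
Proof.
  induction 1 as [|y _ IH]; [lia|]; rewrite rank_S; lia.
Qed.

Lemma rank_le (x : nat) : rank x <= x.
Proof.
  induction x as [|x IH]; [apply le_n|].
  rewrite rank_S; destruct excluded_middle_informative; lia.
Qed.

Lemma rank_surj (e : nat) : exists x, ~ nonmin x /\ rank x = e.
Proof.
  (* The rank stays constant up to the next least element. *)
  assert (N : forall m, exists x, ~ nonmin x /\ rank x = rank m).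
  { intro m; destruct (min_unbounded m) as [y [Hy M]].
    replace y with (m + (y - m)) in M by lia; revert M.
    generalize (y - m) as d; intro d; clear y Hy; revert m.
    induction d as [|d IH]; intros m M.
    - exists m; now rewrite Nat.add_0_r in M.
    - destruct (classic (nonmin m)) as [K|K]; [|now exists m].
      destruct (IH (S m)) as [x [Hx E]]; [now rewrite Nat.add_succ_r in M|].
      exists x; split; [exact Hx|]; rewrite E, rank_S.
      destruct excluded_middle_informative; [lia | easy]. }
  induction e as [|e [x [Hx E]]]; [exact (N 0)|].
  rewrite <- E, <- rank_S_min by exact Hx; apply N.
Qed.

(** Count the numbers below [x] not yet recognized as [nonmin] at stage [s]. This never undercounts,
    and it is exact once all of the finitely many nonminimal ones are recognized. *)
Lemma rank_approximation :
  exists f, recursive (fun q => f (pi1 q) (pi2 q)) /\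
    forall x, (forall s, rank x <= f x s) /\ exists s, f x s = rank x.
Proof.
  destruct (sig_mono sig_nonmin) as [D [[g [Hg HD]] [HM H]]].
  assert (E : forall y s, D y s <-> g ⟨y, s⟩ = 0).
  { intros y s; specialize (HD ⟨y, s⟩); now rewrite pi1_pair, pi2_pair in HD. }
  (* The term [1 - (1 - g ⟨y, s⟩)] is 0 if [D y s] holds and 1 otherwise. *)
  exists (fun x s => sum_below (fun y => 1 - (1 - g ⟨y, s⟩)) x); split.
  - apply (@rec_sum (fun q y => 1 - (1 - g ⟨y, pi2 q⟩))); solve_rec.
  - intro x; split.
    + intro s; induction x as [|x IH]; [apply le_n|].
      rewrite rank_S, sum_below_S.
      destruct excluded_middle_informative as [K|K]; [lia|].
      assert (g ⟨x, s⟩ <> 0); [|lia].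
      intro G; apply K, H; exists s; now apply E.
    + assert (K : exists s, forall y, y < x -> nonmin y -> g ⟨y, s⟩ = 0).
      { induction x as [|x [s Hs]]; [exists 0; intros; lia|].
        destruct (classic (nonmin x)) as [Nx|Nx].
        - destruct (proj1 (H x) Nx) as [t Ht]; exists (s + t); intros y Hy Ny.
          destruct (Nat.eq_dec y x) as [->|].
          + apply E; apply HM with t; [lia | exact Ht].
          + apply E; apply HM with s; [lia|]; apply E, Hs; [lia | exact Ny].
        - exists s; intros y Hy Ny.
          destruct (Nat.eq_dec y x) as [->|]; [easy | apply Hs; [lia|easy]]. }
      destruct K as [s Hs]; exists s.
      induction x as [|x IH]; [reflexivity|].
      rewrite rank_S, sum_below_S, IH by (intros; apply Hs; [lia | easy]).
      f_equal; destruct excluded_middle_informative as [K|K].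
      * rewrite Hs; [reflexivity | lia | exact K].
      * assert (g ⟨x, s⟩ <> 0); [|lia].
        intro G; apply K, H; exists s; now apply E.
Qed.

(* The union of the first [k + 1] classes, ordered by their least elements. *)
Definition initial (k : nat) : Ensemble nat :=
  fun z => exists x, rank x <= k /\ eta x z.

(** Since ranks are approximated from above, [rank x <= k] is confirmed by a single stage. *)
Lemma sig_initial : sig2 initial.
Proof.
  destruct rank_approximation as [f [Hf H]].
  apply sig_ext with (fun p => exists x s,
    f x s <= pi1 p /\ eta x (pi2 p)).
  - apply sig_exists, sig_exists, sig_and; [|solve_sig].
    apply sig_dec, dec_le; [|solve_rec].
    apply (rec_comp2 Hf); solve_rec.
  - intro p; split.
    + intros [x [s [L E]]]; exists x; split; [|exact E].
      pose proof (proj1 (H x) s); lia.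
    + intros [x [L E]]; destruct (proj2 (H x)) as [s Hs].
      exists x, s; split; [lia | exact E].
Qed.

Lemma saturated_initial (k : nat) : saturated (initial k).
Proof.
  intros x y E [z [L K]]; exists z; split; [exact L | now transitivity x].
Qed.

Lemma initial_le (k x : nat) : x <= k -> initial k x.
Proof.
  intro H; exists x; pose proof (rank_le x); split; [lia | reflexivity].
Qed.

Lemma initial_min (k x : nat) : ~ nonmin x -> initial k x -> rank x <= k.
Proof.
  intros M [y [L E]].
  apply Nat.le_trans with (rank y); [|exact L]; apply rank_mono.
  destruct (le_lt_dec x y) as [K|K]; [exact K|]; destruct M; now exists y.
Qed.

Lemma initial_inj (k k' : nat) : initial k = initial k' -> k = k'.
Proof.
  assert (A : forall k k', initial k = initial k' -> k' <= k).
  { intros j j' E; destruct (rank_surj j') as [x [M Hx]].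
    rewrite <- Hx at 1; apply initial_min; [exact M|].
    rewrite E; exists x; split; [lia | reflexivity]. }
  intro E; pose proof (A _ _ E); pose proof (A _ _ (eq_sym E)); lia.
Qed.

(** All numbers of rank at most [k] lie below the least element of rank [S k]. *)
Lemma initial_bounded (k : nat) :
  exists m, forall z, initial k z -> exists x, x < m /\ initial k x /\ eta x z.
Proof.
  destruct (rank_surj (S k)) as [m [M Hm]]; exists m; intros z [x [L E]].
  exists x; repeat split.
  - destruct (le_lt_dec m x) as [K|K]; [|exact K].
    apply rank_mono in K; lia.
  - exists x; split; [exact L | reflexivity].
  - exact E.
Qed.

(* Here [R i] says that the index [i] gets refuted at some stage. The numbering
   enumerates [V i] until this happens, and then completes what it has so far to
   an initial union of classes that is used for no other index. *)
Lemma family_of_unrefuted (R : nat -> Prop) (V : nat -> nat -> Prop) (k0 : nat) :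
  sig R -> sig2 V ->
  (forall i, ~ R i -> saturated (V i)) ->
  (forall i j, ~ R i -> ~ R j -> V i = V j -> i = j) ->
  (forall i k, ~ R i -> k0 <= k -> V i <> initial k) ->
  exists C : Ensemble (Ensemble nat),
    eta_family eta C /\
    (forall i, ~ R i -> C (V i)) /\
    forall L, C L -> (exists i, ~ R i /\ L = V i) \/
                     (exists k, k0 <= k /\ L = initial k).
Proof.
  intros HR HV Vsat Vinj VJ.
  destruct (sig_mono HR) as [D [HD [DM ED]]].
  destruct (sig_mono HV) as [E [HE [EM EE]]].
  assert (EV : forall i y, V i y <-> exists s, E ⟨i, y⟩ s).
  { intros i y; now rewrite <- EE, pi1_pair, pi2_pair. }
  (* Here [t] is the first stage of refutation. The bound [y <= s] puts everything enumerated
     earlier below [t], hence into [initial (k0 + ⟨i, t⟩)]; this number also determines [i]. *)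
  pose (B := fun i x =>
    (exists y, exists s, eta y x /\ ~ D i s /\ E ⟨i, y⟩ s /\ y <= s) \/
    (exists t, D i t /\ (forall u, u < t -> ~ D i u) /\
       initial (k0 + ⟨i, t⟩) x)).
  assert (B1 : forall i, ~ R i -> B i = V i).
  { intros i Ri; apply set_ext; intro x; split.
    - intros [(y & s & Hyx & _ & Hy & _)|(t & Ht & _)].
      + apply (Vsat i Ri y x Hyx), EV; eauto.
      + destruct Ri; apply ED; eauto.
    - intro Hx; apply EV in Hx as [s Hs]; left.
      exists x, (s + x); repeat split; [reflexivity| | |lia].
      + intro K; apply Ri, ED; eauto.
      + apply EM with s; [lia | exact Hs]. }
  assert (B2 : forall i, R i -> exists t, B i = initial (k0 + ⟨i, t⟩)).
  { intros i Ri; apply ED in Ri as [t0 Ht0].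
    assert (T : exists t, D i t /\ forall u, u < t -> ~ D i u).
    { revert Ht0; induction t0 as [t IH] using lt_wf_ind; intro Ht.
      destruct (classic (exists u, u < t /\ D i u)) as [(u & Hu & Du)|N].
      - exact (IH u Hu Du).
      - exists t; split; [exact Ht|]; intros u Hu Du; apply N; eauto. }
    destruct T as (t & Ht & Lt); exists t; apply set_ext; intro x; split.
    - intros [(y & s & Hyx & Hs & _ & Hy)|(t' & Ht' & Lt' & Hx)].
      + apply (saturated_initial Hyx), initial_le.
        assert (s < t).
        { destruct (le_lt_dec t s) as [K|K]; [|exact K].
          destruct Hs; exact (DM i t s K Ht). }
        pose proof (pair_ge_r i t); lia.
      + replace t with t'; [exact Hx|].
        destruct (Nat.lt_total t t') as [K|[K|K]]; [|easy|].
        * destruct (Lt' t K Ht).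
        * destruct (Lt t' K Ht').
    - intro Hx; right; exists t; auto. }
  assert (BC : forall i, (~ R i /\ B i = V i) \/
                 exists k, k0 <= k /\ B i = initial k).
  { intro i; destruct (classic (R i)) as [Ri|Ri]; [|left; auto].
    right; destruct (B2 i Ri) as [t Ht]; eexists; split; [|exact Ht]; lia. }
  assert (Binj : injective _ _ B).
  { intros i j Hij.
    destruct (classic (R i)) as [Ri|Ri], (classic (R j)) as [Rj|Rj].
    + destruct (B2 i Ri) as [t Ht], (B2 j Rj) as [u Hu].
      rewrite Ht, Hu in Hij; apply initial_inj in Hij.
      apply (@pair_inj i t j u); lia.
    + destruct (B2 i Ri) as [t Ht]; rewrite Ht, (B1 j Rj) in Hij.
      destruct (VJ j (k0 + ⟨i, t⟩) Rj); [lia | easy].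
    + destruct (B2 j Rj) as [t Ht]; rewrite Ht, (B1 i Ri) in Hij.
      destruct (VJ i (k0 + ⟨j, t⟩) Ri); [lia | easy].
    + rewrite (B1 i Ri), (B1 j Rj) in Hij; auto. }
  exists (Im _ _ (Full_set nat) B); split; [split; [|split]|split].
  - now apply injective_Im_infinite.
  - intros L [i _ L' ->]; exists (B i); symmetry; apply closure_saturated.
    destruct (BC i) as [[Ri ->]|(k & _ & ->)];
      [now apply Vsat | apply saturated_initial].
  - exists B; split; [|split; [|reflexivity]].
    + apply uniformly_re_sig; unfold B; pose proof sig_initial; solve_sig.
    + exact Binj.
  - intros i Ri; rewrite <- (B1 i Ri).
    apply Im_intro with i; [constructor | reflexivity].
  - intros L [i _ L' ->].
    destruct (BC i) as [[Ri E0]|(k & Hk & E0)]; rewrite E0; eauto.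
Qed.

End PositiveEquivalence.

(** * Locking sequences *)

Definition over (L : nat -> Prop) (s : list (option nat)) : Prop :=
  forall x, List.In (Some x) s -> L x.

Lemma over_app (L : nat -> Prop) (s t : list (option nat)) :
  over L (s ++ t) <-> over L s /\ over L t.
Proof.
  unfold over; split.
  - intro H; split; intros x Hx; apply H, in_or_app; auto.
  - intros [H K] x Hx; apply in_app_or in Hx as [Hx|Hx]; auto.
Qed.

Definition locks (M : list (option nat) -> option nat) (L : nat -> Prop)
    (r : list (option nat)) : Prop :=
  over L r /\ forall t, over L t -> M (r ++ t) = M r.

Definition learns (W : nat -> Ensemble nat) (eta : nat -> nat -> Prop)
    (M : list (option nat) -> option nat) (L : Ensemble nat) : Prop :=
  forall T, text_for T L ->
    exists e, closure eta (W e) = L /\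
      exists N, forall n, N <= n -> M (prefix T n) = Some e.

Definition standard_text (L : nat -> Prop) (n : nat) : option nat :=
  if excluded_middle_informative (L n) then Some n else None.

Lemma standard_text_Some (L : nat -> Prop) (n x : nat) :
  standard_text L n = Some x <-> L x /\ n = x.
Proof.
  unfold standard_text; destruct excluded_middle_informative as [H|H]; split.
  - intro E; injection E as <-; auto.
  - intros [_ ->]; reflexivity.
  - discriminate.
  - now intros [Hx ->].
Qed.

Lemma prefix_app (T : nat -> option nat) (m n : nat) :
  prefix T (m + n) = prefix T m ++ prefix (fun i => T (m + i)) n.
Proof.
  unfold prefix; rewrite seq_app, map_app; f_equal.
  rewrite Nat.add_0_l; clear; revert m; induction n as [|n IH]; intro m; simpl.
  - reflexivity.
  - rewrite Nat.add_0_r, IH, <- seq_shift, map_map; f_equal.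
    apply map_ext; intro i; f_equal; lia.
Qed.

Lemma in_prefix (T : nat -> option nat) (n x : nat) :
  List.In (Some x) (prefix T n) <-> exists m, m < n /\ T m = Some x.
Proof.
  unfold prefix; rewrite in_map_iff; split; intros [m [H K]]; exists m.
  - apply in_seq in K; split; [lia | exact H].
  - split; [exact K | apply in_seq; lia].
Qed.

Lemma prefix_eq (T : nat -> option nat) (s : list (option nat)) :
  (forall n, n < length s -> T n = nth n s None) -> prefix T (length s) = s.
Proof.
  intro H; apply nth_ext with (d := None) (d' := None).
  - unfold prefix; now rewrite length_map, length_seq.
  - unfold prefix; rewrite length_map, length_seq; intros n Hn.
    rewrite nth_indep with (d' := T 0) by now rewrite length_map, length_seq.
    rewrite map_nth, seq_nth by exact Hn; auto.
Qed.

Section Locking.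

Context (W : nat -> Ensemble nat) (eta : nat -> nat -> Prop).
Context (M : list (option nat) -> option nat).

(** Otherwise every sequence over [L] extends to a mind change. Alternating such extensions with the
    items of a text for [L] gives a text on which the learner never converges. *)
Lemma locking_sequence (L : Ensemble nat) :
  learns W eta M L -> exists r, locks M L r.
Proof.
  intro HL; apply NNPP; intro N.
  (* The condition on [r] stands inside the existential quantifier, so that choice yields a total
     function. *)
  assert (X : forall r, exists t, over L r -> over L t /\ M (r ++ t) <> M r).
  { intro r; apply NNPP; intro K; apply N; exists r; split.
    - intros x Hx; apply NNPP; intro Lx; apply K; exists []; intro O.
      destruct (Lx (O x Hx)).
    - intros t Ht; apply NNPP; intro E; apply K; exists t; auto. }
  pose (ext := fun r => proj1_sig (constructive_indefinite_description _ (X r))).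
  assert (Hext : forall r, over L r -> over L (ext r) /\ M (r ++ ext r) <> M r)
    by (intro r; exact (proj2_sig (constructive_indefinite_description _ (X r)))).
  clearbody ext.
  pose (R := nat_rect (fun _ => list (option nat)) []
    (fun k r => (r ++ ext r) ++ [standard_text L k])).
  assert (RS : forall k, R (S k) = (R k ++ ext (R k)) ++ [standard_text L k])
    by reflexivity.
  assert (RL : forall k, k <= length (R k)).
  { induction k as [|k IH]; [lia|].
    rewrite RS, !length_app; simpl; lia. }
  assert (RO : forall k, over L (R k)).
  { induction k as [|k IH]; [intros x []|].
    rewrite RS; apply over_app; split; [apply over_app; split|].
    - exact IH.
    - now apply Hext.
    - intros x [Hx|[]]; now apply standard_text_Some in Hx. }
  assert (RA : forall k d, exists u, R (d + k) = R k ++ u).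
  { intros k d; induction d as [|d [u Hu]].
    - exists []; now rewrite app_nil_r.
    - simpl plus; rewrite RS, Hu; rewrite <- !app_assoc; eauto. }
  (* The sequence [R (S n)] has more than [n] entries, so the default is never reached. *)
  pose (T := fun n => nth n (R (S n)) None).
  assert (TR : forall k n, n < length (R k) -> T n = nth n (R k) None).
  { intros k n Hn; unfold T.
    destruct (RA k (S n)) as [u Hu], (RA (S n) k) as [v Hv].
    rewrite <- (app_nth1 (R (S n)) v) by (specialize (RL (S n)); lia).
    rewrite <- (app_nth1 (R k) u) by exact Hn.
    now rewrite <- Hu, <- Hv, Nat.add_comm. }
  assert (HT : text_for T L).
  { intro x; split.
    - intro Lx; exists (length (R x ++ ext (R x))).
      rewrite (TR (S x)); rewrite RS; [|rewrite !length_app; simpl; lia].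
      rewrite nth_middle; now apply standard_text_Some.
    - intros [n Hn]; apply (RO (S n)); rewrite <- Hn; unfold T.
      apply nth_In, RL. }
  destruct (HL T HT) as [e [_ [m Hm]]].
  destruct (Hext _ (RO m)) as [_ D]; apply D.
  rewrite <- (@prefix_eq T (R m)) at 3; [|apply TR].
  rewrite <- (@prefix_eq T (R m ++ ext (R m))).
  - rewrite !Hm; [reflexivity | apply RL|].
    rewrite length_app; specialize (RL m); lia.
  - intros n Hn; rewrite (TR (S m)); rewrite RS.
    + apply app_nth1, Hn.
    + rewrite length_app; lia.
Qed.

(** Continuing [r] by the standard text gives a text for [L] on which the learner converges to
    [M r]. *)
Lemma locks_value (L : Ensemble nat) (r : list (option nat)) :
  locks M L r -> learns W eta M L ->
  exists e, M r = Some e /\ closure eta (W e) = L.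
Proof.
  intros [HO HM] HL.
  pose (T := fun n => if n <? length r then nth n r None
                      else standard_text L (n - length r)).
  assert (E : forall n, prefix T (length r + n) = r ++ prefix (standard_text L) n).
  { intro n; rewrite prefix_app; f_equal.
    - apply prefix_eq; intros i Hi; unfold T.
      now destruct (Nat.ltb_spec i (length r)); [|lia].
    - unfold prefix; apply map_ext; intro i; unfold T.
      destruct (Nat.ltb_spec (length r + i) (length r)); [lia|].
      f_equal; lia. }
  assert (HT : text_for T L).
  { intro x; split.
    - intro Lx; exists (length r + x); unfold T.
      destruct (Nat.ltb_spec (length r + x) (length r)); [lia|].
      apply standard_text_Some; split; [exact Lx | lia].
    - intros [n Hn]; unfold T in Hn.
      destruct (Nat.ltb_spec n (length r)).
      + apply HO; rewrite <- Hn; now apply nth_In.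
      + now apply standard_text_Some in Hn. }
  destruct (HL T HT) as (e & He & N & HN); exists e; split; [|exact He].
  rewrite <- (HN (length r + N)) by lia; rewrite E; symmetry; apply HM.
  intros x Hx; apply in_prefix in Hx as [m [_ Hm]].
  now apply standard_text_Some in Hm.
Qed.

(** The sequence locks both sets, so the one conjecture [M r] is correct for both. *)
Lemma locks_unique (L L' : Ensemble nat) (r : list (option nat)) :
  learns W eta M L -> learns W eta M L' ->
  (forall x, L' x -> L x) -> over L' r ->
  (forall t, over L t -> M (r ++ t) = M r) -> L = L'.
Proof.
  intros HL HL' I HO HM.
  destruct (@locks_value L r) as (e & He & <-); [|exact HL|].
  - split; [|exact HM]; intros x Hx; apply I, HO, Hx.
  - destruct (@locks_value L' r) as (e' & He' & <-); [|exact HL'|].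
    + split; [exact HO|]; intros t Ht; apply HM; intros x Hx; apply I, Ht, Hx.
    + congruence.
Qed.

End Locking.

Lemma text_over (T : nat -> option nat) (L : Ensemble nat) (n : nat) :
  text_for T L -> over L (prefix T n).
Proof.
  intros HT x Hx; apply in_prefix in Hx as [m [_ Hm]]; apply HT; eauto.
Qed.

Lemma text_eventually (T : nat -> option nat) (L : Ensemble nat) (m : nat) :
  text_for T L -> exists N, forall n, N <= n ->
    forall x, x < m -> L x -> List.In (Some x) (prefix T n).
Proof.
  intro HT; induction m as [|m [N HN]].
  - exists 0; intros; lia.
  - destruct (classic (L m)) as [Lm|Lm].
    + destruct (proj1 (HT m) Lm) as [k Hk]; exists (N + S k).
      intros n Hn x Hx Lx; destruct (Nat.eq_dec x m) as [->|].
      * apply in_prefix; exists k; split; [lia | exact Hk].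
      * apply HN; [lia | lia | exact Lx].
    + exists N; intros n Hn x Hx Lx; destruct (Nat.eq_dec x m) as [->|].
      * contradiction.
      * apply HN; [lia | lia | exact Lx].
Qed.

(** * Predicates on coded sequences *)

(** The code bounds the length, and positions past the end read as pauses, so a bounded quantifier
    over positions suffices. *)
Lemma sig_over (A : nat -> nat -> Prop) (r : nat -> nat) :
  sig2 A -> recursive r -> sig (fun n => over (A n) (decode (r n))).
Proof.
  intros HA Hr.
  apply sig_ext with (fun n => forall k, k < r n ->
    entry (r n) k = 0 \/ A n (Nat.pred (entry (r n) k))).
  - solve_sig.
  - intro n; split.
    + intros H x Hx; apply In_nth with (d := None) in Hx as [k [Hk E]].
      pose proof (length_encode (decode (r n))) as L; rewrite encode_decode in L.
      destruct (H k) as [K|K]; [lia| |];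
        rewrite entry_decode, E in K; [discriminate | exact K].
    + intros H k _; rewrite entry_decode.
      destruct (nth k (decode (r n)) None) as [x|] eqn:E; [|now left].
      right; change (A n x); apply H; rewrite <- E; apply nth_In.
      destruct (le_lt_dec (length (decode (r n))) k) as [K|K]; [|exact K].
      rewrite nth_overflow in E by exact K; discriminate.
Qed.

#[global] Hint Extern 1 (sig _) =>
  lazymatch goal with
  | |- sig (fun n => over (@?A n) (decode (@?r n))) =>
      apply (@sig_over A r); [solve_sig | solve_rec]
  end : recdb.

Definition occurs (r x : nat) : Prop := exists k, k < r /\ entry r k = S x.

Lemma occurs_encode (s : list (option nat)) (x : nat) :
  occurs (encode_seq s) x <-> List.In (Some x) s.
Proof.
  unfold occurs; split.
  - intros [k [_ H]]; rewrite entry_encode in H.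
    destruct (nth k s None) as [y|] eqn:E; [|discriminate].
    injection H as ->; rewrite <- E; apply nth_In.
    destruct (le_lt_dec (length s) k) as [K|K]; [|exact K].
    rewrite nth_overflow in E by exact K; discriminate.
  - intro H; apply In_nth with (d := None) in H as [k [Hk E]].
    exists k; rewrite entry_encode, E; split; [|reflexivity].
    pose proof (length_encode s); lia.
Qed.

Lemma dec_occurs : dec2 occurs.
Proof. unfold occurs; solve_dec. Qed.

Definition span (eta : nat -> nat -> Prop) (r y : nat) : Prop :=
  exists x, occurs r x /\ eta x y.

Lemma sig_span (eta : nat -> nat -> Prop) : sig2 eta -> sig2 (span eta).
Proof. intro H; pose proof dec_occurs; unfold span; solve_sig. Qed.

Lemma span_sound (eta : nat -> nat -> Prop) (L : Ensemble nat)
    (T : nat -> option nat) (n y : nat) :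
  saturated eta L -> text_for T L -> span eta (encode_seq (prefix T n)) y -> L y.
Proof.
  intros S HT [x [Hx E]]; apply occurs_encode in Hx.
  exact (S x y E (text_over HT Hx)).
Qed.

(** The hypothesis on [m] says that [L] is covered by the classes of finitely many of its elements;
    all of these eventually occur in the text. *)
Lemma span_complete (eta : nat -> nat -> Prop) (L : Ensemble nat)
    (T : nat -> option nat) (m : nat) :
  text_for T L ->
  (forall z, L z -> exists x, x < m /\ L x /\ eta x z) ->
  exists N, forall n, N <= n ->
    forall y, L y -> span eta (encode_seq (prefix T n)) y.
Proof.
  intros HT Hm; destruct (text_eventually m HT) as [N HN].
  exists N; intros n Hn y Hy; destruct (Hm y Hy) as (x & Hx & Lx & E).
  exists x; split; [now apply occurs_encode, HN | exact E].
Qed.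

(** * Mind changes, and learners given by r.e. conjectures *)

Definition change (M : list (option nat) -> option nat) (r t : nat) : Prop :=
  M (decode r ++ decode t) <> M (decode r).

Lemma sig_change (M : list (option nat) -> option nat) :
  recursive_learner M -> sig2 (change M).
Proof.
  intros [c Hc]; pose (m := fun n => encode_option (M (decode n))).
  assert (Hm : recursive m).
  { exists c; intro n; rewrite <- (encode_decode n) at 1; apply Hc. }
  apply sig_ext with (fun p => m (append (pi1 p) (pi2 p)) <> m (pi1 p)).
  - solve_sig.
  - intro p; unfold m, change; rewrite append_decode, decode_encode.
    split; intros H K; apply H.
    + now rewrite K.
    + now apply encode_option_inj.
Qed.

(** Acceptability translates the conjectures [H], indexed by the code of the data, into indices for
    [W]; the learner outputs the translated code. *)
Lemma bc_learnable (W : nat -> Ensemble nat) (eta : nat -> nat -> Prop)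
    (C : Ensemble (Ensemble nat)) (H : nat -> nat -> Prop) :
  acceptable W -> Equivalence eta -> sig2 H ->
  (forall L, C L -> saturated eta L /\ forall T, text_for T L ->
     exists N, forall n, N <= n ->
       forall y, H (encode_seq (prefix T n)) y <-> L y) ->
  behaviourally_correctly_learnable W eta C.
Proof.
  intros [_ HW] He Hs HC.
  destruct (HW H) as [f [Hf Ef]]; [now apply uniformly_re_sig|].
  exists (fun s => Some (f (encode_seq s))); split.
  - destruct (rec_S Hf) as [c Hc]; exists c; intro s; apply Hc.
  - intros L HL T HT; destruct (HC L HL) as [S HN], (HN T HT) as [N K].
    exists N; intros n Hn; exists (f (encode_seq (prefix T n))).
    split; [reflexivity|]; rewrite <- Ef, (set_ext (K n Hn)).
    now apply closure_saturated.
Qed.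

(** * Uniqueness of witnesses *)

(* Among the codes of a witness [r] with a stage [s] confirming [A u r], the
   least one that is never refuted is unique; adding the first stage at which all
   smaller codes are refuted makes it recognizable by a co-r.e. condition. *)
Lemma unique_witness (A B : nat -> nat -> Prop) :
  sig2 A -> sig2 B ->
  exists Bad, sig2 Bad /\
    (forall u w w', ~ Bad u w -> ~ Bad u w' -> w = w') /\
    (forall u w, ~ Bad u w -> A u (pi1 w) /\ ~ B u (pi1 w)) /\
    (forall u r, A u r -> ~ B u r -> exists w, ~ Bad u w).
Proof.
  intros HA HB.
  destruct (sig_mono HA) as [DA [DAd [_ EA]]].
  destruct (sig_mono HB) as [DB [DBd [DBm EB]]].
  assert (EA' : forall u r, A u r <-> exists s, DA ⟨u, r⟩ s).
  { intros u r; now rewrite <- EA, pi1_pair, pi2_pair. }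
  assert (EB' : forall u r, B u r <-> exists s, DB ⟨u, r⟩ s).
  { intros u r; now rewrite <- EB, pi1_pair, pi2_pair. }
  (* A code [v] is a pair of a witness and a stage meant to confirm [A]; by stage [t] it fails if
     that confirmation is wrong or [B] has been confirmed. *)
  pose (bad := fun u v t => ~ DA ⟨u, pi1 v⟩ (pi2 v) \/ DB ⟨u, pi1 v⟩ t).
  pose (below := fun u v t => forall v', v' < v -> bad u v' t).
  (* Here [w] is [⟨r, ⟨s, t⟩⟩], with [t] claimed to be the first stage at which all codes below
     [⟨r, s⟩] are refuted. *)
  pose (code := fun w => ⟨pi1 w, pi1 (pi2 w)⟩).
  assert (bad_mono : forall u v s t, s <= t -> bad u v s -> bad u v t).
  { intros u v s t L [K|K]; [now left | right; eauto]. }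
  pose (Bad := fun u w => (exists t, bad u (code w) t) \/
    ~ below u (code w) (pi2 (pi2 w)) \/
    exists t, t < pi2 (pi2 w) /\ below u (code w) t).
  assert (BadI : forall u w, ~ Bad u w -> (forall t, ~ bad u (code w) t) /\
    below u (code w) (pi2 (pi2 w)) /\
    forall t, below u (code w) t -> pi2 (pi2 w) <= t).
  { unfold Bad; intros u w K; repeat split.
    - intros t Ht; apply K; eauto.
    - apply NNPP; intro N; apply K; auto.
    - intros t Ht; destruct (le_lt_dec (pi2 (pi2 w)) t) as [L|L]; [exact L|].
      destruct K; eauto. }
  exists Bad; split; [|split; [|split]].
  - unfold Bad, below, bad, code; apply sig_or; [solve_sig|].
    apply sig_dec; solve_dec.
  - intros u w w' K K'; apply BadI in K as (G & Bl & Lt).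
    apply BadI in K' as (G' & Bl' & Lt').
    assert (E : code w = code w').
    { destruct (Nat.lt_total (code w) (code w')) as [L|[L|L]]; [|exact L|].
      - destruct (G _ (Bl' _ L)).
      - destruct (G' _ (Bl _ L)). }
    assert (E2 : pi2 (pi2 w) = pi2 (pi2 w')).
    { apply Nat.le_antisymm; [apply Lt; rewrite E | apply Lt'; rewrite <- E];
        assumption. }
    apply pair_inj in E as [E0 E1].
    rewrite <- (pair_pi w), <- (pair_pi w'), <- (pair_pi (pi2 w)),
      <- (pair_pi (pi2 w')); congruence.
  - intros u w K; apply BadI in K as (G & _ & _); unfold code, bad in G.
    rewrite pi1_pair, pi2_pair in G; split.
    + apply NNPP; intro N; apply (G 0); left; intro D; apply N, EA'; eauto.
    + intro N; apply EB' in N as [t Ht]; apply (G t); now right.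
  - intros u r Ar Br.
    assert (V : exists v, forall t, ~ bad u v t).
    { apply EA' in Ar as [s Hs]; exists ⟨r, s⟩; intros t [K|K];
        rewrite pi1_pair, ?pi2_pair in K; [contradiction|].
      apply Br, EB'; eauto. }
    (* Below the least code that is never refuted, all codes are refuted, and by monotonicity at a
       common stage. *)
    assert (V' : exists v, (forall t, ~ bad u v t) /\ exists t, below u v t).
    { destruct V as [v0 V]; revert V.
      induction v0 as [v IH] using lt_wf_ind; intro V.
      destruct (classic (exists v', v' < v /\ forall t, ~ bad u v' t))
        as [(v' & L & V')|N]; [exact (IH v' L V')|].
      exists v; split; [exact V|].
      assert (X : forall v', v' < v -> exists t, bad u v' t).
      { intros v' L; apply NNPP; intro K; apply N; exists v'; split; [exact L|].
        intros t Ht; apply K; eauto. }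
      clear - X bad_mono; unfold below; induction v as [|v IH].
      - exists 0; intros; lia.
      - destruct IH as [t Ht]; [auto|]; destruct (X v) as [s Hs]; [lia|].
        exists (s + t); intros v' L; destruct (Nat.eq_dec v' v) as [->|].
        + apply bad_mono with s; [lia | exact Hs].
        + apply bad_mono with t; [lia | apply Ht; lia]. }
    destruct V' as (v & G & t0 & Ht0).
    assert (X : exists t, below u v t /\ forall t', t' < t -> ~ below u v t').
    { revert Ht0; induction t0 as [t IH] using lt_wf_ind; intro Ht.
      destruct (classic (exists t', t' < t /\ below u v t')) as [(t' & L & K)|N].
      - exact (IH t' L K).
      - exists t; split; [exact Ht|]; intros t' L K; apply N; eauto. }
    destruct X as (t & Ht & Lt).
    exists ⟨pi1 v, ⟨pi2 v, t⟩⟩.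
    assert (E : code ⟨pi1 v, ⟨pi2 v, t⟩⟩ = v).
    { unfold code; now rewrite !pi2_pair, !pi1_pair, pair_pi. }
    unfold Bad; rewrite E, !pi2_pair.
    intros [[s Hs]|[K|(t' & L & K)]]; [exact (G s Hs) | exact (K Ht)|].
    exact (Lt t' L K).
Qed.

(** * Unions of two classes *)

Definition two_classes (eta : nat -> nat -> Prop) (u v : nat) : Ensemble nat :=
  fun y => eta u y \/ eta v y.

Lemma saturated_two_classes (eta : nat -> nat -> Prop) (u v : nat) :
  Equivalence eta -> saturated eta (two_classes eta u v).
Proof.
  intros He x y E [H|H]; [left | right]; now transitivity x.
Qed.

Lemma bc_learnable_finite (W : nat -> Ensemble nat) (eta : nat -> nat -> Prop)
    (C : Ensemble (Ensemble nat)) :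
  acceptable W -> Equivalence eta -> sig2 eta ->
  (forall L, C L -> saturated eta L /\ exists m, forall z, L z ->
     exists x, x < m /\ L x /\ eta x z) ->
  behaviourally_correctly_learnable W eta C.
Proof.
  intros HW He Hs HC; apply bc_learnable with (span eta); auto using sig_span.
  intros L HL; destruct (HC L HL) as [S [m Hm]]; split; [exact S|].
  intros T HT; destruct (span_complete HT Hm) as [N HN].
  exists N; intros n Hn y; split; [now apply span_sound | now apply HN].
Qed.

(** Pairs of least elements with [0 < u <= v] index these sets without repetition. They omit 0,
    which every initial union contains. *)
Lemma two_classes_family (W : nat -> Ensemble nat) (eta : nat -> nat -> Prop) :
  acceptable W -> Equivalence eta -> sig2 eta ->
  ~ Finite _ (Im _ _ (Full_set nat) (eq_class eta)) ->
  exists C, eta_family eta C /\ behaviourally_correctly_learnable W eta C /\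
    forall u v, ~ eta 0 u -> ~ eta 0 v -> C (two_classes eta u v).
Proof.
  intros HW He Hs Hinf.
  pose proof (sig_nonmin Hs) as Hn.
  assert (Pos : forall u, ~ nonmin eta u -> 0 < u -> ~ eta u 0).
  { intros u M L E; apply M; exists 0; split; [exact L | now symmetry]. }
  destruct (@family_of_unrefuted eta He Hs Hinf
    (fun i => ~ (0 < pi1 i /\ pi1 i <= pi2 i) \/
       nonmin eta (pi1 i) \/ nonmin eta (pi2 i))
    (fun i => two_classes eta (pi1 i) (pi2 i)) 0) as (C & HC & CV & CL).
  - solve_sig.
  - unfold two_classes; solve_sig.
  - intros i _; now apply saturated_two_classes.
  - intros i j Ri Rj E.
    assert (Mi : ~ nonmin eta (pi1 i) /\ ~ nonmin eta (pi2 i) /\ pi1 i <= pi2 i)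
      by tauto.
    assert (Mj : ~ nonmin eta (pi1 j) /\ ~ nonmin eta (pi2 j) /\ pi1 j <= pi2 j)
      by tauto.
    clear Ri Rj; destruct Mi as (M1 & M2 & L), Mj as (M3 & M4 & L').
    assert (X : forall u v a, two_classes eta u v a -> ~ nonmin eta u ->
      ~ nonmin eta v -> ~ nonmin eta a -> u = a \/ v = a).
    { intros u v a [K|K] Mu Mv Ma; [left | right]; now apply (min_unique He). }
    assert (Xl : forall u v, two_classes eta u v u) by (left; reflexivity).
    assert (Xr : forall u v, two_classes eta u v v) by (right; reflexivity).
    rewrite <- (pair_pi i), <- (pair_pi j).
    cut (pi1 i = pi1 j /\ pi2 i = pi2 j); [intros [-> ->]; reflexivity|].
    (* Each of the four least elements appears in the other pair, and the pairs are ordered. *)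
    pose proof (Xl (pi1 i) (pi2 i)) as A1; rewrite E in A1; apply X in A1; auto.
    pose proof (Xr (pi1 i) (pi2 i)) as A2; rewrite E in A2; apply X in A2; auto.
    pose proof (Xl (pi1 j) (pi2 j)) as A3; rewrite <- E in A3; apply X in A3; auto.
    pose proof (Xr (pi1 j) (pi2 j)) as A4; rewrite <- E in A4; apply X in A4; auto.
    lia.
  - intros i k Ri _ E.
    assert (Mi : (0 < pi1 i /\ pi1 i <= pi2 i) /\
      ~ nonmin eta (pi1 i) /\ ~ nonmin eta (pi2 i)) by tauto.
    destruct Mi as ((L1 & L2) & M1 & M2).
    assert (K : two_classes eta (pi1 i) (pi2 i) 0)
      by (rewrite E; apply (initial_le He); lia).
    destruct K as [K|K]; revert K; apply Pos; auto; lia.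
  - exists C; split; [exact HC|]; split.
    + apply bc_learnable_finite; auto.
      intros L HL; destruct (CL L HL) as [(i & _ & ->)|(k & _ & ->)].
      * split; [now apply saturated_two_classes|].
        exists (S (pi1 i + pi2 i)); intros z [K|K].
        -- exists (pi1 i); split; [lia|]; split; [left; reflexivity | exact K].
        -- exists (pi2 i); split; [lia|]; split; [right; reflexivity | exact K].
      * split; [now apply saturated_initial | now apply initial_bounded].
    + assert (Min : forall u v, ~ nonmin eta u -> ~ nonmin eta v -> 0 < u ->
        u <= v -> C (two_classes eta u v)).
      { intros u v Mu Mv L1 L2; specialize (CV ⟨u, v⟩).
        rewrite pi1_pair, pi2_pair in CV; apply CV; tauto. }
      intros u v Hu Hv.
      destruct (min_representative He u) as (u' & _ & Mu & Eu).
      destruct (min_representative He v) as (v' & _ & Mv & Ev).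
      assert (Lu : 0 < u') by (destruct u'; [contradiction | lia]).
      assert (Lv : 0 < v') by (destruct v'; [contradiction | lia]).
      assert (Sub : forall a a' y, eta a' a -> (eta a y <-> eta a' y)).
      { intros a a' y K; split; intro K'; [now transitivity a|].
        transitivity a'; [now symmetry | exact K']. }
      destruct (le_lt_dec u' v') as [L|L].
      * replace (two_classes eta u v) with (two_classes eta u' v'); [auto|].
        apply set_ext; intro y; unfold two_classes.
        rewrite (Sub u u'), (Sub v v') by assumption; tauto.
      * replace (two_classes eta u v) with (two_classes eta v' u').
        { apply Min; auto; lia. }
        apply set_ext; intro y; unfold two_classes.
        rewrite (Sub u u'), (Sub v v') by assumption; tauto.
Qed.

(* A locking sequence [r] for the class of [u] turns its complement into an r.e.
   set: by locking uniqueness, [y] is not equivalent to [u] if and only if the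
   learner changes its mind on some continuation of [r] within the classes of [u]
   and [y]. Such a sequence is found in the limit, and [w] codes the limit. *)
Lemma complements_in_the_limit (W : nat -> Ensemble nat)
    (eta : nat -> nat -> Prop) (M : list (option nat) -> option nat) :
  Equivalence eta -> sig2 eta -> recursive_learner M ->
  (forall u v, ~ eta 0 u -> ~ eta 0 v -> learns W eta M (two_classes eta u v)) ->
  exists Bad Co, sig2 Bad /\ sig3 Co /\
    (forall u w w', ~ Bad u w -> ~ Bad u w' -> w = w') /\
    (forall u, ~ eta 0 u -> exists w, ~ Bad u w) /\
    forall u w y, ~ eta 0 u -> ~ Bad u w -> (Co u w y <-> ~ eta u y).
Proof.
  intros He Hs HM HL; pose proof (sig_change HM) as Hc.
  assert (E1 : forall u, two_classes eta u u = eta u)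
    by (intro u; apply set_ext; intro y; unfold two_classes; tauto).
  destruct (@unique_witness
    (fun u r => over (eta u) (decode r))
    (fun u r => exists q, over (eta u) (decode q) /\ change M r q))
    as (Bad & HB & BU & BS & BE).
  - solve_sig.
  - solve_sig.
  (* The learner is only known to succeed on classes other than that of 0, so this class is put into
     the complement separately. *)
  - exists Bad, (fun u w y => eta 0 y \/
      exists q, over (two_classes eta u y) (decode q) /\ change M (pi1 w) q).
    split; [exact HB|]; split; [|split; [exact BU|split]].
    + unfold two_classes; solve_sig.
    + intros u Hu; destruct (@locking_sequence W eta M (eta u)) as [r [Or Lr]].
      { rewrite <- E1; auto. }
      apply (BE u (encode_seq r)); [now rewrite decode_encode|].
      intros (q & Oq & Cq); apply Cq; rewrite decode_encode; auto.
    + intros u w y Hu Bw; destruct (BS u w Bw) as [Or Nr]; split.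
      * intros [H0|(q & Oq & Cq)] E.
        -- apply Hu; transitivity y; [exact H0 | now symmetry].
        -- apply Nr; exists q; split; [|exact Cq]; intros x Hx.
           destruct (Oq x Hx) as [K|K]; [exact K | now transitivity y].
      * intro Ny; destruct (classic (eta 0 y)) as [H0|H0]; [now left | right].
        apply NNPP; intro N; apply Ny.
        (* Without a mind change over the larger set, the locking sequence for the class of [u]
           would lock both sets. *)
        assert (E : two_classes eta u y = eta u).
        { apply (@locks_unique W eta M _ _ (decode (pi1 w))).
          - auto.
          - rewrite <- E1; auto.
          - intros x Hx; now left.
          - exact Or.
          - intros t Ht; apply NNPP; intro K; apply N; exists (encode_seq t).
            unfold change; now rewrite decode_encode. }
        rewrite <- E; right; reflexivity.
Qed.

(** * Complements of two and of three classes *)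

Section CofiniteFamily.

Context (W : nat -> Ensemble nat) (HW : acceptable W).
Context (eta : nat -> nat -> Prop) (He : Equivalence eta) (Hs : sig2 eta).
Context (Hinf : ~ Finite _ (Im _ _ (Full_set nat) (eq_class eta))).
(** These are the data provided by [complements_in_the_limit]. *)
Context (Bad : nat -> nat -> Prop) (Co : nat -> nat -> nat -> Prop).
Context (HBad : sig2 Bad) (HCo : sig3 Co).
Context (Bad_unique : forall u w w', ~ Bad u w -> ~ Bad u w' -> w = w').
Context (Bad_exists : forall u, ~ eta 0 u -> exists w, ~ Bad u w).
Context (Co_spec : forall u w y,
  ~ eta 0 u -> ~ Bad u w -> (Co u w y <-> ~ eta u y)).
Context (b : nat) (b_min : ~ nonmin eta b) (b_pos : 0 < b).
Context (wb : nat) (Hwb : ~ Bad b wb).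

Lemma min_not_zero (x : nat) : ~ nonmin eta x -> 0 < x -> ~ eta 0 x.
Proof. intros M L E; apply M; now exists 0. Qed.

Definition co_two (x w y : nat) : Prop := Co b wb y /\ Co x w y.

Lemma co_two_spec (x w y : nat) :
  ~ nonmin eta x -> b < x -> ~ Bad x w ->
  (co_two x w y <-> ~ eta b y /\ ~ eta x y).
Proof.
  intros M L B; unfold co_two.
  rewrite !Co_spec; auto; [tauto | |]; apply min_not_zero; auto; lia.
Qed.

(* A witness for the second kind of sets is [⟨w, ⟨w', ⟨z, ⟨r, t⟩⟩⟩⟩]: the set
   omits the classes of [b], [x] and [z], the complements of the latter two being
   given by [w] and [w'], [t] is a stage at which the approximation [f] to the
   rank of [x] is final, and [r] codes a locking sequence, on the complement of
   the classes of [b] and [x], for the learner with that rank. *)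
Definition wit_x (r : nat) : nat := pi1 r.
Definition wit_z (r : nat) : nat := pi1 (pi2 r).
Definition omitted (r : nat) : nat := pi1 (pi2 (pi2 r)).
Definition lock (r : nat) : nat := pi1 (pi2 (pi2 (pi2 r))).
Definition stage (r : nat) : nat := pi2 (pi2 (pi2 (pi2 r))).

Definition co_three (x r y : nat) : Prop :=
  co_two x (wit_x r) y /\ Co (omitted r) (wit_z r) y.

Context (f : nat -> nat -> nat) (Hf : recursive (fun q => f (pi1 q) (pi2 q))).
Context (f_spec : forall x,
  (forall s, rank eta x <= f x s) /\ exists s, f x s = rank eta x).

(** The third omitted class lies above [x], so [x] can still be recovered, and the sequence is over
    the smaller set, so it can lock both sets. *)
Definition witness_pos (x r : nat) : Prop :=
  x < omitted r /\ over (co_three x r) (decode (lock r)).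

(** A learner is represented by an index of the r.e. set of pairs [⟨r, q⟩] such that it changes its
    mind when [q] is appended to [r]. This index is the first component of the rank of [x]. *)
Definition witness_neg (x r : nat) : Prop :=
  Bad x (wit_x r) \/ Bad (omitted r) (wit_z r) \/ nonmin eta (omitted r) \/
  (exists s, f x s < f x (stage r)) \/
  exists q, over (co_two x (wit_x r)) (decode q) /\
            W (pi1 (f x (stage r))) ⟨lock r, q⟩.

Lemma sig_witness_pos : sig2 witness_pos.
Proof.
  unfold witness_pos, co_three, co_two, omitted, lock, wit_x, wit_z; solve_sig.
Qed.

Lemma sig_witness_neg : sig2 witness_neg.
Proof.
  destruct HW as [HW' _]; apply uniformly_re_sig in HW'.
  pose proof (sig_nonmin Hs).
  unfold witness_neg, co_two, omitted, lock, wit_x, wit_z, stage.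
  apply sig_or; [solve_sig|]; apply sig_or; [solve_sig|].
  apply sig_or; [solve_sig|]; apply sig_or.
  - apply sig_exists, sig_dec, dec_lt; apply (rec_comp2 Hf); solve_rec.
  - apply sig_exists, sig_and; [solve_sig|].
    apply (sig2_comp HW'); [apply rec_pi1, (rec_comp2 Hf)|]; solve_rec.
Qed.

(** [Bad3] results from [unique_witness], so the actual witness is [pi1 w]. *)
Context (Bad3 : nat -> nat -> Prop) (HBad3 : sig2 Bad3).
Context (Bad3_unique : forall x w w', ~ Bad3 x w -> ~ Bad3 x w' -> w = w').
Context (Bad3_sound : forall x w, ~ Bad3 x w ->
  witness_pos x (pi1 w) /\ ~ witness_neg x (pi1 w)).
Context (Bad3_complete : forall x r, witness_pos x r -> ~ witness_neg x r ->
  exists w, ~ Bad3 x w).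

Lemma co_three_spec (x w : nat) :
  ~ nonmin eta x -> b < x -> ~ Bad3 x w ->
  x < omitted (pi1 w) /\ ~ nonmin eta (omitted (pi1 w)) /\
  forall y, co_three x (pi1 w) y <->
    ~ eta b y /\ ~ eta x y /\ ~ eta (omitted (pi1 w)) y.
Proof.
  intros M L B; destruct (Bad3_sound B) as [[P _] N].
  assert (Mz : ~ nonmin eta (omitted (pi1 w)))
    by (intro K; apply N; unfold witness_neg; tauto).
  split; [exact P|]; split; [exact Mz|]; intro y; unfold co_three.
  rewrite co_two_spec, Co_spec; [tauto| | | | |]; auto.
  - apply min_not_zero; [exact Mz | lia].
  - intro K; apply N; unfold witness_neg; tauto.
  - intro K; apply N; unfold witness_neg; tauto.
Qed.

(** An index is [⟨x, ⟨kind, w⟩⟩]: kind 0 omits two classes, kind 1 three; higher kinds are always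
    refuted. *)
Definition member (i y : nat) : Prop :=
  (pi1 (pi2 i) = 0 /\ co_two (pi1 i) (pi2 (pi2 i)) y) \/
  (0 < pi1 (pi2 i) /\ co_three (pi1 i) (pi1 (pi2 (pi2 i))) y).

Definition refuted (i : nat) : Prop :=
  nonmin eta (pi1 i) \/ pi1 i <= b \/
  (pi1 (pi2 i) = 0 /\ Bad (pi1 i) (pi2 (pi2 i))) \/
  (pi1 (pi2 i) = 1 /\ Bad3 (pi1 i) (pi2 (pi2 i))) \/
  1 < pi1 (pi2 i).

Lemma sig_member : sig2 member.
Proof.
  unfold member, co_three, co_two, omitted, wit_x, wit_z; solve_sig.
Qed.

Lemma sig_refuted : sig refuted.
Proof.
  pose proof (sig_nonmin Hs); unfold refuted; solve_sig.
Qed.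

Lemma unrefuted (i : nat) :
  ~ refuted i -> ~ nonmin eta (pi1 i) /\ b < pi1 i /\
  ((pi1 (pi2 i) = 0 /\ ~ Bad (pi1 i) (pi2 (pi2 i)) /\
    forall y, member i y <-> ~ eta b y /\ ~ eta (pi1 i) y) \/
   (pi1 (pi2 i) = 1 /\ ~ Bad3 (pi1 i) (pi2 (pi2 i)) /\
    exists z, pi1 i < z /\ ~ nonmin eta z /\
    forall y, member i y <-> ~ eta b y /\ ~ eta (pi1 i) y /\ ~ eta z y)).
Proof.
  unfold refuted; intro H.
  assert (M : ~ nonmin eta (pi1 i)) by tauto.
  assert (L : b < pi1 i) by lia.
  split; [exact M|]; split; [exact L|].
  assert (K : pi1 (pi2 i) = 0 \/ pi1 (pi2 i) = 1) by lia.
  destruct K as [K|K]; [left | right]; (split; [exact K|]).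
  - assert (B : ~ Bad (pi1 i) (pi2 (pi2 i))) by tauto.
    split; [exact B|]; intro y; unfold member.
    rewrite co_two_spec by assumption; rewrite K; intuition lia.
  - assert (B : ~ Bad3 (pi1 i) (pi2 (pi2 i))) by tauto.
    split; [exact B|]; destruct (co_three_spec M L B) as (P & Mz & E).
    eexists; split; [exact P|]; split; [exact Mz|].
    intro y; unfold member; rewrite E, K; intuition lia.
Qed.

Lemma index_eq (i j : nat) :
  pi1 i = pi1 j -> pi1 (pi2 i) = pi1 (pi2 j) -> pi2 (pi2 i) = pi2 (pi2 j) ->
  i = j.
Proof.
  intros E1 E2 E3; rewrite <- (pair_pi i), <- (pair_pi j).
  rewrite <- (pair_pi (pi2 i)), <- (pair_pi (pi2 j)); congruence.
Qed.

Lemma min_eq (x y : nat) :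
  ~ nonmin eta x -> ~ nonmin eta y -> ~ ~ eta x y -> x = y.
Proof. intros Mx My E; apply (min_unique He); auto; now apply NNPP. Qed.

(** Apart from [b], [x] is the smallest least element omitted; the kind shows in whether a third
    class is omitted, and the witness is unique. *)
Lemma member_inj (i j : nat) :
  ~ refuted i -> ~ refuted j -> member i = member j -> i = j.
Proof.
  intros Ri Rj E; apply unrefuted in Ri as (Mi & Li & Di).
  apply unrefuted in Rj as (Mj & Lj & Dj).
  assert (EV : forall y, member i y <-> member j y) by (intro; now rewrite E).
  assert (R : forall x, eta x x) by reflexivity.
  assert (X : forall x x' z', ~ nonmin eta x -> ~ nonmin eta x' ->
    ~ nonmin eta z' -> b < x ->
    ~ (~ eta b x /\ ~ eta x' x /\ ~ eta z' x) -> x = x' \/ x = z').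
  { intros x x' z' M M' M'' L H.
    assert (Nb : ~ eta b x) by (intro K; apply M; now exists b).
    destruct (classic (eta x' x)) as [K|K].
    - left; symmetry; now apply (min_unique He).
    - right; symmetry; apply min_eq; auto. }
  destruct Di as [(Ki & Bi & Ei)|(Ki & Bi & z & Lz & Mz & Ei)],
    Dj as [(Kj & Bj & Ej)|(Kj & Bj & z' & Lz' & Mz' & Ej)].
  - assert (Ex : pi1 i = pi1 j).
    { destruct (X (pi1 i) (pi1 j) (pi1 j)) as [K|K]; auto.
      specialize (EV (pi1 i)); rewrite Ei, Ej in EV.
      specialize (R (pi1 i)); tauto. }
    apply index_eq; [exact Ex | congruence|].
    rewrite Ex in Bi; eapply Bad_unique; eauto.
  - assert (Ex : pi1 j = pi1 i).
    { destruct (X (pi1 j) (pi1 i) (pi1 i)) as [K|K]; auto.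
      specialize (EV (pi1 j)); rewrite Ei, Ej in EV.
      specialize (R (pi1 j)); tauto. }
    destruct (X z' (pi1 i) (pi1 i)) as [K|K]; auto; try lia.
    specialize (EV z'); rewrite Ei, Ej in EV.
    specialize (R z'); tauto.
  - assert (Ex : pi1 i = pi1 j).
    { destruct (X (pi1 i) (pi1 j) (pi1 j)) as [K|K]; auto.
      specialize (EV (pi1 i)); rewrite Ei, Ej in EV.
      specialize (R (pi1 i)); tauto. }
    destruct (X z (pi1 j) (pi1 j)) as [K|K]; auto; try lia.
    specialize (EV z); rewrite Ei, Ej in EV.
    specialize (R z); tauto.
  - assert (Ex : pi1 i = pi1 j).
    { destruct (X (pi1 i) (pi1 j) z') as [K|K]; auto.
      - specialize (EV (pi1 i)); rewrite Ei, Ej in EV.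
        specialize (R (pi1 i)); tauto.
      - destruct (X (pi1 j) (pi1 i) z) as [K'|K']; auto; try lia.
        specialize (EV (pi1 j)); rewrite Ei, Ej in EV.
        specialize (R (pi1 j)); tauto. }
    apply index_eq; [exact Ex | congruence|].
    rewrite Ex in Bi; eapply Bad3_unique; eauto.
Qed.

Lemma saturated_member (i : nat) : ~ refuted i -> saturated eta (member i).
Proof.
  intros Ri y y' E; apply unrefuted in Ri as (_ & _ & D).
  assert (X : forall u, ~ eta u y -> ~ eta u y').
  { intros u N K; apply N; transitivity y'; [exact K | now symmetry]. }
  destruct D as [(_ & _ & Ei)|(_ & _ & z & _ & _ & Ei)]; rewrite !Ei;
    intuition eauto.
Qed.

Lemma member_initial (i k : nat) :
  ~ refuted i -> b <= k -> member i <> initial eta k.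
Proof.
  intros Ri Hk E; apply unrefuted in Ri as (_ & _ & D).
  assert (K : member i b) by (rewrite E; now apply (initial_le He)).
  assert (R : eta b b) by reflexivity.
  destruct D as [(_ & _ & Ei)|(_ & _ & z & _ & _ & Ei)]; rewrite Ei in K; tauto.
Qed.

(** * Learnability of the family of complements *)

Context (C : Ensemble (Ensemble nat)).
Context (C_member : forall i, ~ refuted i -> C (member i)).
Context (C_inv : forall L, C L -> (exists i, ~ refuted i /\ L = member i) \/
                                  exists k, b <= k /\ L = initial eta k).

(* If [b] does not occur, the classes met so far are completed by the elements
   that lie in [member i] for all small unrefuted indices [i] with the presumed
   first component. There are at most two such indices in the limit, and if the
   text is for the larger set then its extra class eventually occurs. *)
Lemma bc_learnable_cofinite : behaviourally_correctly_learnable W eta C.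
Proof.
  destruct (sig_mono Hs) as [D [HD [DM ED]]].
  assert (ED' : forall x y, eta x y <-> exists s, D ⟨x, y⟩ s).
  { intros x y; now rewrite <- ED, pi1_pair, pi2_pair. }
  (* The presumed [x] is the least number beyond [b] that has not occurred and is not yet known to
     be equivalent to [b]; the code of the data doubles as the stage. *)
  pose (least := fun r x => b < x /\ ~ occurs r x /\ ~ D ⟨b, x⟩ r /\
    forall x', x' < x -> x' <= b \/ occurs r x' \/ D ⟨b, x'⟩ r).
  (* The bound [i < r] keeps the condition r.e. *)
  apply bc_learnable with (fun r y => span eta r y \/
    exists x, (~ occurs r b /\ least r x) /\
      forall i, i < r -> ~ (pi1 i = x) \/ refuted i \/ member i y); auto.
  { pose proof (sig_span Hs); pose proof sig_refuted; pose proof sig_member.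
    pose proof dec_occurs; unfold least.
    apply sig_or; [solve_sig|]; apply sig_exists, sig_and.
    - apply sig_dec; solve_dec.
    - solve_sig. }
  intros L HL; destruct (C_inv HL) as [(i0 & R0 & ->)|(k & Hk & ->)].
  - pose proof (saturated_member R0) as Sat; split; [exact Sat|].
    intros T HT; pose proof R0 as R0'.
    apply unrefuted in R0' as (M0 & L0 & D0).
    set (x0 := pi1 i0) in *.
    assert (Mem : forall i y, ~ refuted i -> pi1 i = x0 -> member i y ->
      ~ eta b y /\ ~ eta x0 y).
    { intros i y Ri Ei Hy; apply unrefuted in Ri as (_ & _ & Di).
      rewrite Ei in Di; destruct Di as [(_ & _ & F)|(_ & _ & z & _ & _ & F)];
        rewrite F in Hy; tauto. }
    assert (Low : forall x', x' < x0 -> ~ eta b x' -> member i0 x').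
    { intros x' Lx Nb.
      assert (N0 : ~ eta x0 x')
        by (intro K; apply M0; exists x'; split; [exact Lx | now symmetry]).
      destruct D0 as [(_ & _ & F)|(_ & _ & z & Lz & Mz & F)]; apply F;
        [tauto|]; repeat split; auto.
      intro K; apply Mz; exists x'; split; [lia | now symmetry]. }
    (* What the target has beyond another unrefuted set with the same [x] is the one class of the
       omitted [z]. *)
    assert (Extra : exists m, forall i y, ~ refuted i -> pi1 i = x0 ->
      member i0 y -> ~ member i y ->
      exists z, z < m /\ member i0 z /\ eta z y).
    { assert (Kind : forall i y, ~ refuted i -> pi1 i = x0 -> member i0 y ->
        ~ member i y -> pi1 (pi2 i) = 1 /\ ~ Bad3 x0 (pi2 (pi2 i))).
      { intros i y Ri Ei Hy Ny; apply unrefuted in Ri as (_ & _ & Di).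
        rewrite Ei in Di; destruct Di as [(_ & _ & F)|(K & B & _)]; [|auto].
        destruct Ny; apply F, (Mem i0); auto. }
      destruct (classic (exists w, ~ Bad3 x0 w)) as [[w Hw]|N].
      - destruct (co_three_spec M0 L0 Hw) as (Lz & Mz & Ez).
        exists (S (omitted (pi1 w))); intros i y Ri Ei Hy Ny.
        exists (omitted (pi1 w)); split; [lia|].
        destruct (Kind i y Ri Ei Hy Ny) as [K B].
        rewrite (Bad3_unique Hw B) in *.
        destruct (Mem i0 y R0 eq_refl Hy) as [Nb Nx]; split.
        + destruct D0 as [(_ & _ & F)|(K0 & B0 & _)].
          * apply F; split; intro E; apply Mz; (eexists; split; [|exact E]); lia.
          * destruct Ny; replace i with i0; [exact Hy|].
            apply index_eq; [now rewrite Ei | congruence|].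
            now apply (@Bad3_unique x0).
        + apply NNPP; intro E; apply Ny; right; rewrite K, Ei.
          split; [lia|]; apply Ez; auto.
      - exists 0; intros i y Ri Ei Hy Ny.
        destruct N; exists (pi2 (pi2 i)); now apply (Kind i y). }
    destruct Extra as [m Hm].
    destruct (text_eventually x0 HT) as [N1 HN1].
    destruct (text_eventually m HT) as [N3 HN3].
    assert (St : exists s, forall x', x' < x0 -> eta b x' -> D ⟨b, x'⟩ s).
    { clear - ED' DM; induction x0 as [|x [s IH]]; [exists 0; lia|].
      destruct (classic (eta b x)) as [K|K].
      - apply ED' in K as [t Ht]; exists (s + t); intros x' L E.
        destruct (Nat.eq_dec x' x) as [->|].
        + apply DM with t; [lia | exact Ht].
        + apply DM with s; [lia|]; apply IH; [lia | exact E].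
      - exists s; intros x' L E; destruct (Nat.eq_dec x' x) as [->|];
          [easy | apply IH; [lia | exact E]]. }
    destruct St as [N2 HN2].
    (* From here on the guess is [x0], the extra class has occurred, and [i0 < r], so the target
       itself bounds the conjecture. *)
    exists (N1 + N2 + N3 + S i0); intros n Hn.
    set (r := encode_seq (prefix T n)).
    assert (Lr : n <= r).
    { unfold r; etransitivity; [|apply length_encode].
      unfold prefix; now rewrite length_map, length_seq. }
    assert (Occ : forall x, occurs r x -> member i0 x).
    { intros x Hx; apply occurs_encode in Hx; exact (text_over HT Hx). }
    assert (R : forall x, eta x x) by reflexivity.
    assert (Nb : ~ occurs r b).
    { intro K; apply Occ, Mem in K; auto; destruct K as [K _]; now apply K. }
    assert (Lx : least r x0).
    { split; [exact L0|]; split; [|split].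
      - intro K; apply Occ, Mem in K; auto; destruct K as [_ K]; now apply K.
      - intro K; apply M0; exists b; split; [exact L0|]; apply ED'; eauto.
      - intros x' Lx'; destruct (classic (eta b x')) as [K|K].
        + right; right; apply DM with N2; [lia | auto].
        + right; left; apply occurs_encode, HN1; auto; lia. }
    intro y; split.
    + intros [Hy|(x & (_ & Lst) & Hy)].
      * exact (span_sound Sat HT Hy).
      * assert (Ex : x = x0).
        { destruct Lst as (A1 & A2 & A3 & A4), Lx as (B1 & B2 & B3 & B4).
          destruct (Nat.lt_total x x0) as [K|[K|K]]; [|exact K|].
          - destruct (B4 x K) as [?|[?|?]]; [lia | easy | easy].
          - destruct (A4 x0 K) as [?|[?|?]]; [lia | easy | easy]. }
        destruct (Hy i0) as [K|[K|K]]; [lia| | |exact K].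
        -- now destruct K.
        -- contradiction.
    + intro Hy.
      destruct (classic (exists i, ~ refuted i /\ pi1 i = x0 /\ ~ member i y))
        as [(i & Ri & Ei & Ny)|N].
      * left; destruct (Hm i y Ri Ei Hy Ny) as (z & Lz & Hz & E).
        exists z; split; [|exact E]; apply occurs_encode, HN3; auto; lia.
      * right; exists x0; split; [auto|]; intros i _.
        destruct (classic (pi1 i = x0)) as [Ei|Ei]; [right | now left].
        destruct (classic (refuted i)) as [Ri|Ri]; [now left | right].
        apply NNPP; intro K; apply N; eauto.
  - pose proof (@saturated_initial eta He k) as Sat; split; [exact Sat|].
    intros T HT; destruct (initial_bounded He Hinf k) as [m Hm].
    destruct (span_complete HT Hm) as [N1 HN1].
    (* Since [b <= k], the text eventually shows [b], which leaves only the closure of the data. *)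
    destruct (text_eventually (S b) HT) as [N2 HN2].
    exists (N1 + N2); intros n Hn y; split.
    + intros [Hy|(x & (Nb & _) & _)]; [exact (span_sound Sat HT Hy)|].
      destruct Nb; apply occurs_encode, HN2; [lia | lia|].
      now apply (initial_le He).
    + intro Hy; left; apply HN1; [lia | exact Hy].
Qed.

(** For the [x] whose rank encodes the mind changes of [M], a locking sequence for the larger set
    ensures that the smaller one is in the family. The witness for the latter makes [M] conjecture
    the same set for both. *)
Lemma not_explanatory_cofinite : ~ explanatorily_learnable W eta C.
Proof.
  intros (M & HM & HL); change (forall L, C L -> learns W eta M L) in HL.
  pose proof (sig_change HM) as Hc; destruct HW as [_ HW'].
  destruct (HW' (fun _ p => change M (pi1 p) (pi2 p))) as [g [_ Hg]].
  { apply uniformly_re_sig; solve_sig. }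
  assert (Hj : forall r q, W (g 0) ⟨r, q⟩ <-> change M r q).
  { intros r q; rewrite <- (Hg 0), pi1_pair, pi2_pair; tauto. }
  set (j := g 0) in *; clearbody j.
  (* The padding [S b] forces [b < x], since ranks do not exceed their arguments. *)
  destruct (rank_surj He Hinf ⟨j, S b⟩) as (x & Mx & Ex).
  assert (Lx : b < x).
  { pose proof (rank_le eta x); pose proof (pair_ge_r j (S b)); lia. }
  assert (Hj' : forall t, (forall s, f x t <= f x s) -> pi1 (f x t) = j).
  { intros t Ht; destruct (f_spec x) as [F [s Hs']].
    specialize (Ht s); specialize (F t).
    replace (f x t) with ⟨j, S b⟩ by lia; apply pi1_pair. }
  destruct (@Bad_exists x) as [w Hw]; [apply min_not_zero; auto; lia|].
  set (i0 := ⟨x, ⟨0, w⟩⟩).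
  assert (P0 : pi1 i0 = x /\ pi1 (pi2 i0) = 0 /\ pi2 (pi2 i0) = w).
  { unfold i0; now rewrite !pi2_pair, !pi1_pair. }
  destruct P0 as (P1 & P2 & P3).
  assert (R0 : ~ refuted i0).
  { unfold refuted; rewrite P1, P2, P3; intuition lia. }
  assert (E0 : forall y, member i0 y <-> co_two x w y).
  { intro y; unfold member; rewrite P1, P2, P3; intuition lia. }
  destruct (locking_sequence (HL _ (C_member R0))) as [r [Or Lr]].
  assert (Bd : exists m, forall y, List.In (Some y) r -> y < m).
  { clear; induction r as [|o r [m Hm]]; [exists 0; intros y []|].
    exists (m + S (encode_option o)); intros y [->|Hy]; [simpl; lia|].
    specialize (Hm y Hy); lia. }
  (* A least element [z] beyond [x] and all entries of [r] has a class that does not meet [r]. *)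
  destruct Bd as [m Hm], (min_unbounded He Hinf (S (x + m))) as (z & Lz & Mz).
  destruct (@Bad_exists z) as [w' Hw']; [apply min_not_zero; auto; lia|].
  destruct (f_spec x) as [F [t Ht]].
  set (v := ⟨w, ⟨w', ⟨z, ⟨encode_seq r, t⟩⟩⟩⟩).
  assert (V1 : wit_x v = w) by apply pi1_pair.
  assert (V2 : wit_z v = w') by (unfold wit_z, v; now rewrite pi2_pair, pi1_pair).
  assert (V3 : omitted v = z)
    by (unfold omitted, v; now rewrite !pi2_pair, pi1_pair).
  assert (V4 : lock v = encode_seq r)
    by (unfold lock, v; now rewrite !pi2_pair, pi1_pair).
  assert (V5 : stage v = t) by (unfold stage, v; now rewrite !pi2_pair).
  assert (Hv : exists w1, ~ Bad3 x w1).
  { apply (Bad3_complete (r := v)).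
    - unfold witness_pos, co_three; rewrite V1, V2, V3, V4, decode_encode.
      split; [lia|]; intros y Hy; split; [now apply E0, Or|].
      apply Co_spec; [apply min_not_zero; auto; lia | exact Hw'|].
      intro K; apply Mz; exists y; split; [specialize (Hm y Hy); lia|].
      now symmetry.
    - unfold witness_neg; rewrite V1, V2, V3, V4, V5.
      intros [K|[K|[K|[[s K]|(q & Oq & K)]]]]; try contradiction.
      + specialize (F s); lia.
      + rewrite Hj' in K by (intro s; specialize (F s); lia).
        apply Hj in K; apply K; rewrite decode_encode; apply Lr.
        intros y Hy; now apply E0, Oq. }
  destruct Hv as [w1 Hw1]; set (i1 := ⟨x, ⟨1, w1⟩⟩).
  assert (Q0 : pi1 i1 = x /\ pi1 (pi2 i1) = 1 /\ pi2 (pi2 i1) = w1).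
  { unfold i1; now rewrite !pi2_pair, !pi1_pair. }
  destruct Q0 as (Q1 & Q2 & Q3).
  assert (R1 : ~ refuted i1).
  { unfold refuted; rewrite Q1, Q2, Q3; intuition lia. }
  assert (E1 : forall y, member i1 y <-> co_three x (pi1 w1) y).
  { intro y; unfold member; rewrite Q1, Q2, Q3; intuition lia. }
  (* The surviving witness need not be [v]; only the two conditions on it are used. *)
  destruct (Bad3_sound Hw1) as [[_ Pos] Neg]; unfold witness_neg in Neg.
  assert (Ew : wit_x (pi1 w1) = w) by (apply (@Bad_unique x); tauto).
  assert (E : member i0 = member i1).
  { apply (@locks_unique W eta M _ _ (decode (lock (pi1 w1)))); auto.
    - intros y Hy; apply E0; rewrite <- Ew; now apply E1.
    - intros y Hy; now apply E1, Pos.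
    - intros q Hq; apply NNPP; intro K; apply Neg.
      right; right; right; right; exists (encode_seq q).
      rewrite Ew, decode_encode; split.
      + intros y Hy; now apply E0, Hq.
      + rewrite Hj'.
        * apply Hj; unfold change; now rewrite decode_encode.
        * intro s; destruct (le_lt_dec (f x (stage (pi1 w1))) (f x s)) as [L|L];
            [exact L|].
          destruct Neg; right; right; right; left; eauto. }
  apply member_inj in E; [congruence | exact R0 | exact R1].
Qed.

End CofiniteFamily.

(** * Case distinction on the explanatory learnability of the unions of two classes *)

Theorem theorem3 (W : nat -> Ensemble nat) (hW : acceptable W)
    (eta : nat -> nat -> Prop) (heta : positive_equivalence eta) :
  exists C : Ensemble (Ensemble nat),
    eta_family eta C /\
    behaviourally_correctly_learnable W eta C /\
    ~ explanatorily_learnable W eta C.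
Proof.
  destruct heta as (He & Hre & Hinf).
  assert (Hs : sig2 eta) by now apply uniformly_re_sig.
  destruct (two_classes_family hW He Hs Hinf) as (C1 & HC1 & BC1 & TC1).
  destruct (classic (explanatorily_learnable W eta C1)) as [[M [HM HL]]|N];
    [|now exists C1].
  destruct (@complements_in_the_limit W eta M He Hs HM)
    as (Bad & Co & HBad & HCo & BU & BE & CS); [intros u v Hu Hv; exact (HL _ (TC1 u v Hu Hv))|].
  destruct (min_unbounded He Hinf 1) as (b & Lb & Mb).
  destruct (BE b) as [wb Hwb]; [apply min_not_zero; auto|].
  destruct (rank_approximation Hs) as (f & Hf & Ef).
  destruct (unique_witness (sig_witness_pos HCo b wb)
    (sig_witness_neg hW Hs HBad HCo b wb Hf)) as (Bad3 & HB3 & U3 & S3 & C3).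
  (* The threshold [b] makes every added initial union contain [b], which all the complements
     omit. *)
  destruct (@family_of_unrefuted eta He Hs Hinf
    (refuted eta Bad b Bad3) (member Co b wb) b) as (C & HC & CM & CI).
  - now apply sig_refuted.
  - now apply sig_member.
  - intros i Ri; exact (saturated_member He CS Mb Lb Hwb S3 Ri).
  - intros i j; exact (@member_inj _ _ He _ _ BU CS _ Mb Lb _ Hwb _ _ U3 S3 i j).
  - intros i k; exact (@member_initial _ _ He _ _ CS _ Mb Lb _ Hwb _ _ S3 i k).
  - exists C; split; [exact HC|]; split.
    + exact (bc_learnable_cofinite hW He Hs Hinf HBad HCo CS Mb Lb Hwb HB3 U3 S3 CI).
    + exact (not_explanatory_cofinite hW He Hinf BU BE CS Mb Lb Hwb Ef U3 S3 C3 CM).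
Qed.
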